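(* Let $\omega_k'\ge0$ be given for each $k$ with $G_k\not\subseteq G$. Let $P_G\in\mathbb R^{n\times n}$, depending on $X$ only, satisfy $$P_G=P_G^2=P_G^T,\qquad \|P_GQ_{G_k\setminus G}\|_S\le\omega_k'\ \text{ for all } k \text{ with } G_k\not\subseteq G,\qquad \|P_GQ_G^\perp\|_S<1 .$$ Let $\{\hat\beta^{(init)},\hat\sigma\}$ be estimators such that, for a $(g,s)$ strongly group sparse $\beta^*$, $$\Big|\frac{\hat\sigma}{\sigma^*}-1\Big|+\frac1{n^{1/2}}\sum_{j=1}^M\frac{\omega_{*,j}}{\sigma}\big\|X_{G_j}\hat\beta_{G_j}^{(init)}-X_{G_j}\beta_{G_j}^*\big\|_2=O_{\mathbb P}\Big(\frac{s+g\log M}{n}\Big),$$ where $\omega_{*,j}=\sqrt{|G_j|/n}+\sqrt{(2/n)\log M}$ and $\sigma^*=\|y-X\beta^*\|_2/\sqrt n$. Let $$\hat\beta_G=\hat\beta_G^{(init)}+(P_GX_G)^\dagger P_G(y-X\hat\beta^{(init)}),\qquad \hat\mu_G=X_G\hat\beta_G .$$ Suppose $\varepsilon\sim N_n(0,\sigma^2I_n)$, $\mathrm{rank}(X_G)=|G|$, and, as $n\to\infty$, $$\frac{|G|}{n}\to0,\qquad \frac{s+g\log M}{n^{1/2}}\Big(\frac{|G|^{1/2}}{n^{1/2}}+\max_{k:\,G_k\not\subseteq G}M_k\frac{\omega_k'}{\omega_{*,k}}\Big)\to0,$$ where $M_k=\max\{\|X_{G_k\setminus G}u_{G_k\setminus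 G}\|_2:\ \|X_{G_k}u_{G_k}\|_2=1\}$. Let $k_G=\mathrm{rank}(P_G)$, $\mu_G^*=X_G\beta_G^*$, and $T_G=\hat\sigma^{-1}\big\|P_G\big(y-\sum_{k:\,G_k\not\subseteq G}X_{G_k\setminus G}\hat\beta^{(init)}_{G_k\setminus G}\big)\big\|_2$. Then $$\sup_t\Big|\mathbb P\big\{\|P_GX_G(\hat\beta_G-\beta_G^* )\|_2^2\le\hat\sigma^2t\big\}-\mathbb P\{\chi^2_{k_G}\le t\}\Big|\to0,$$ $$\sup_t\Big|\mathbb P\big\{\|P_GQ_G(\hat\mu_G-\mu_G^* )\|_2^2\le\hat\sigma^2t\big\}-\mathbb P\{\chi^2_{k_G}\le t\}\Big|\to0,$$ if $\mu_G^*=0$ then $\sup_t\big|\mathbb P\{T_G^2\le t\}-\mathbb P\{\chi^2_{k_G}\le t\}\big|\to0$, and $$(P_GQ_G)(\hat\mu_G-\mu_G^* )/\hat\sigma=(P_GX_G)(\hat\beta_G-\beta_G^* )/\hat\sigma=N_n(0,P_G)+o_{\mathbb P}(1).$$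
   Context: Model: $y=X\beta^*+\varepsilon$, $X\in\mathbb R^{n\times p}$ (treated as fixed), $\beta^*\in\mathbb R^p$, $\sigma>0$ unknown. The index set $\{1,\dots,p\}$ is partitioned into given disjoint groups $G_1,\dots,G_M$; $G\subset\{1,\dots,p\}$ is a given nonempty variable group of interest, not necessarily a union of the $G_j$. Asymptotics are as $n\to\infty$; $p,M,X,G_j,G,\beta^*,\sigma,g,s$ may all depend on $n$. Notation: for $A\subset\{1,\dots,p\}$, $u_A$ is the subvector of $u$ with indices in $A$, $X_A$ the submatrix of $X$ with columns in $A$, $Q_A$ the orthogonal projection in $\mathbb R^n$ onto the column space of $X_A$, $Q_A^\perp=I_n-Q_A$. $\|\cdot\|_S$ is the spectral norm and $\dagger$ the Moore–Penrose inverse. A maximum over the empty set is $0$. Strong group sparsity: $\beta^*$ is $(g,s)$ strongly group sparse if there is $S^*\subset\{1,\dots,M\}$ with $|S^*|\le g$, $|G_{S^*}|\le s$ and $\mathrm{supp}(\beta^* )\subset G_{S^*}:=\bigcup_{j\in S^*}G_j$. $\chi^2_k$ is a chi-squared variable with $k$ degrees of freedom ($\chi^2_0=0$). ''$V=N_n(0,P_G)+o_{\mathbb P}(1)$'' means that $V=\xi+r$ with $\xi\sim N_n(0,P_G)$ and $\|r\|_2\to0$ in probability. *)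

(* Defs.v *)
From HB Require Import structures.
From mathcomp Require Import all_boot all_order all_algebra.
From mathcomp Require Import all_classical all_reals all_analysis.

Set Implicit Arguments.
Unset Strict Implicit.
Unset Printing Implicit Defensive.

Import Order.TTheory GRing.Theory Num.Theory.
Import numFieldNormedType.Exports.

Local Open Scope classical_set_scope.
Local Open Scope ring_scope.

(* Matrices over a measurable type carry the product sigma-algebra; for R^n
   this is the Borel sigma-algebra. *)
Definition measure_matrix_display : measure_display -> measure_display.
Proof. exact. Qed.

Section measurable_matrix.
Context {d} {T : measurableType d} {m n : nat}.

Definition matrix_measurable : set (set 'M[T]_(m, n)) :=
  <<s \bigcup_(ij in [set: 'I_m * 'I_n])
        preimage_set_system setT (fun A : 'M[T]_(m, n) => A ij.1 ij.2)
          measurable >>.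

Let matrix0 : matrix_measurable set0.
Proof. exact: sigma_algebra0. Qed.

Let matrixC A : matrix_measurable A -> matrix_measurable (~` A).
Proof. exact: sigma_algebraC. Qed.

Let matrix_bigcup (F : (set 'M[T]_(m, n))^nat) :
  (forall i, matrix_measurable (F i)) -> matrix_measurable (\bigcup_i F i).
Proof. exact: sigma_algebra_bigcup. Qed.

HB.instance Definition _ := @isMeasurable.Build (measure_matrix_display d)
  'M[T]_(m, n) matrix_measurable matrix0 matrixC matrix_bigcup.

End measurable_matrix.

Lemma measurable_fun_matrix d d' (S : measurableType d) (T : measurableType d')
    m n (f : S -> 'M[T]_(m, n)) :
  (forall i j, measurable_fun [set: S] (fun x => f x i j)) ->
  measurable_fun [set: S] f.
Proof.
move=> mf; apply: (@measurability _ _ _ _ _ _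
  (\bigcup_(ij in [set: 'I_m * 'I_n])
    preimage_set_system setT (fun A : 'M[T]_(m, n) => A ij.1 ij.2) measurable)).
  by [].
move=> _ [B [ij _ [C mC <-]] <-]; rewrite !setTI.
by have := mf ij.1 ij.2 measurableT C mC; rewrite setTI.
Qed.

Section linear_algebra.
Context {R : realType}.

Definition enorm n (v : 'cV[R]_n) : R := Num.sqrt (\sum_(i < n) v i 0 ^+ 2).

Definition spectral_norm m n (A : 'M[R]_(m, n)) : R :=
  sup [set enorm (A *m x) | x in [set x : 'cV[R]_n | enorm x <= 1]].

(* The Penrose equations, which determine B uniquely; existence is pinvP. *)
Definition is_pinv m n (A : 'M[R]_(m, n)) (B : 'M[R]_(n, m)) : Prop :=
  [/\ A *m B *m A = A, B *m A *m B = B,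
      (A *m B)^T = A *m B & (B *m A)^T = B *m A].

Definition pinv m n (A : 'M[R]_(m, n)) : 'M[R]_(n, m) :=
  xget 0 [set B | is_pinv A B].

(* Q is the orthogonal projection onto the column space of A; existence is
   orthprojP. *)
Definition is_orthproj m n (A : 'M[R]_(m, n)) (Q : 'M[R]_m) : Prop :=
  [/\ Q^T = Q, Q *m Q = Q & (Q^T == A^T)%MS].

Definition orthproj m n (A : 'M[R]_(m, n)) : 'M[R]_m :=
  xget 0 [set Q | is_orthproj A Q].

Lemma mulmx_trmx_unit m n (B : 'M[R]_(m, n)) :
  row_free B -> B *m B^T \in unitmx.
Proof.
move=> fB; rewrite -row_free_unit -kermx_eq0; apply/eqP/row_matrixP => i.
rewrite row0; set u := row i _.
have uBB : u *m B *m B^T = 0.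
  by rewrite -mulmxA; apply/eqP; rewrite -sub_kermx row_sub.
suff uB0 : u *m B = 0 by apply: (row_free_inj fB); rewrite uB0 mul0mx.
have : (u *m B) *m (u *m B)^T = 0 by rewrite trmx_mul mulmxA uBB mul0mx.
move=> /matrixP/(_ 0 0); rewrite !mxE => /eqP.
rewrite psumr_eq0 => [/allP h|j _]; last by rewrite !mxE -expr2 sqr_ge0.
apply/rowP => j; have := h j (mem_index_enum _).
by rewrite !mxE -expr2 sqrf_eq0 => /eqP.
Qed.

Lemma is_pinv_factor m r n (C : 'M[R]_(m, r)) (F : 'M[R]_(r, n)) :
  row_full C -> row_free F ->
  is_pinv (C *m F) (F^T *m invmx (F *m F^T) *m (invmx (C^T *m C) *m C^T)).
Proof.
move=> fC fF; have uF := mulmx_trmx_unit fF.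
have uC : C^T *m C \in unitmx.
  have := @mulmx_trmx_unit _ _ C^T; rewrite trmxK; apply.
  by rewrite /row_free mxrank_tr.
set B := _ *m (_ *m _).
have AB : C *m F *m B = C *m invmx (C^T *m C) *m C^T.
  by rewrite /B !mulmxA -(mulmxA C F) (mulmxK uF).
have BA : B *m (C *m F) = F^T *m invmx (F *m F^T) *m F.
  by rewrite /B -!mulmxA (mulmxA C^T) (mulKmx uC).
split.
- by rewrite AB -!mulmxA (mulmxA C^T) (mulKmx uC).
- by rewrite BA /B -!mulmxA (mulmxA F F^T) (mulKVmx uF).
- by rewrite AB !trmx_mul trmxK trmx_inv trmx_mul trmxK mulmxA.
- by rewrite BA !trmx_mul trmxK trmx_inv trmx_mul trmxK mulmxA.
Qed.

Lemma pinvP m n (A : 'M[R]_(m, n)) : is_pinv A (pinv A).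
Proof.
have := is_pinv_factor (col_base_full A) (row_base_free A).
rewrite mulmx_base => AB; exact: (xgetPex 0 (ex_intro _ _ AB)).
Qed.

Lemma orthprojP m n (A : 'M[R]_(m, n)) : is_orthproj A (orthproj A).
Proof.
have [ABA BAB ABs BAs] := pinvP A.
suff QA : is_orthproj A (A *m pinv A).
  exact: (xgetPex 0 (ex_intro (is_orthproj A) _ QA)).
split => //; first by rewrite mulmxA ABA.
apply/andP; split; first by rewrite trmx_mul submxMl.
by rewrite -{1}ABA trmx_mul submxMl.
Qed.

Definition subv p (A : {set 'I_p}) (u : 'cV[R]_p) : 'cV[R]_#|A| :=
  rowsub (fun i : 'I_#|A| => enum_val i) u.

Definition subm n p (A : {set 'I_p}) (X : 'M[R]_(n, p)) : 'M[R]_(n, #|A|) :=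
  colsub (fun i : 'I_#|A| => enum_val i) X.

End linear_algebra.

Section group_structure.
Context {R : realType} {n p M : nat}.
Implicit Types (X : 'M[R]_(n, p)) (Gr : 'I_M -> {set 'I_p}) (G : {set 'I_p}).

Definition group_partition Gr : Prop :=
  injective Gr /\ finset.partition [set Gr j | j : 'I_M]%SET [set: 'I_p]%SET.

Definition strongly_group_sparse Gr (g s : nat) (beta : 'cV[R]_p) : Prop :=
  exists S : {set 'I_M},
    [/\ (#|S| <= g)%N, (#|(\bigcup_(j in S) Gr j)%SET| <= s)%N &
        [set i | beta i 0 != 0]%SET \subset (\bigcup_(j in S) Gr j)%SET].

Definition omega_star Gr (j : 'I_M) : R :=
  Num.sqrt (#|Gr j|%:R / n%:R) + Num.sqrt (2 / n%:R * ln M%:R).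

(* The maximum of a set of nonnegative numbers, 0 if the set is empty and +oo
   if it is unbounded (which happens exactly when some u has X_{G_k} u = 0 but
   X_{G_k \ G} u <> 0, X_{G_k} being nonzero). *)
Definition Mfac X Gr G (k : 'I_M) : \bar R :=
  ereal_sup (0%E |` [set (enorm (subm (Gr k :\: G) X *m subv (Gr k :\: G) u))%:E
    | u in [set u : 'cV[R]_p | enorm (subm (Gr k) X *m subv (Gr k) u) = 1]]).

Definition max_ratio X Gr G (omega' : 'I_M -> R) : \bar R :=
  \big[maxe/0%E]_(k | ~~ (Gr k \subset G))
    (Mfac X Gr G k * (omega' k / omega_star Gr k)%:E)%E.

Definition group_error X Gr (b beta : 'cV[R]_p) (sigma : R) : R :=
  \sum_(j < M) omega_star Gr j / sigma *
    enorm (subm (Gr j) X *m subv (Gr j) b - subm (Gr j) X *m subv (Gr j) beta).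

Definition debiased X G (PG : 'M[R]_n) (b : 'cV[R]_p) (y : 'cV[R]_n) :
    'cV[R]_#|G| :=
  subv G b + pinv (PG *m subm G X) *m PG *m (y - X *m b).

Definition test_stat X Gr G (PG : 'M[R]_n) (b : 'cV[R]_p) (sh : R)
    (y : 'cV[R]_n) : R :=
  sh^-1 * enorm (PG *m (y - \sum_(k < M | ~~ (Gr k \subset G))
    subm (Gr k :\: G) X *m subv (Gr k :\: G) b)).

End group_structure.

Section gaussian.
Context {R : realType}.

Definition cons_cV n (xz : measurableTypeR R * 'cV[R]_n) : 'cV[R]_n.+1 :=
  col_mx (const_mx xz.1 : 'cV[R]_1) xz.2.

Lemma measurable_cons_cV n : measurable_fun setT (@cons_cV n).
Proof.
apply: measurable_fun_matrix => i j; rewrite /cons_cV.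
rewrite -[i](@splitK 1 n); case: (fintype.split (i : 'I_(1 + n))) => k /=.
  rewrite (_ : (fun x => _) = fst); first exact: measurable_fst.
  by apply/funext => x; rewrite [LHS]col_mxEu mxE.
rewrite (_ : (fun x => _) = (fun z : 'cV[R]_n => z k j) \o snd); last first.
  by apply/funext => x; rewrite [LHS]col_mxEd.
have mproj : measurable_fun [set: 'cV[R]_n] (fun z : 'cV[R]_n => z k j).
  move=> _ B mB; rewrite setTI; apply: sub_sigma_algebra.
  by exists (k, j) => //; exists B => //; rewrite setTI.
by apply: (measurableT_comp mproj); exact: measurable_snd.
Qed.

HB.instance Definition _ n := @isMeasurableFun.Build _ _ _ _
  (@cons_cV n) (@measurable_cons_cV n).

(* joint law of n independent N(0,1) variables *)
Fixpoint std_normal n : probability 'cV[R]_n R :=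
  if n is n'.+1 then
    distribution (normal_prob 0 1 \x std_normal n')%E (@cons_cV n')
  else dirac (0 : 'cV[R]_0).

(* V ~ N_n(0, Sigma), possibly degenerate: V has the law of A Z with Z a
   standard normal vector and A A^T = Sigma. *)
Definition is_gaussian d (T : measurableType d) (P : probability T R) n
    (V : {RV P >-> 'cV[R]_n}) (Sigma : 'M[R]_n) : Prop :=
  exists m (A : 'M[R]_(n, m)), A *m A^T = Sigma /\
    forall B : set 'cV[R]_n, measurable B ->
      distribution P V B = std_normal m [set z | B (A *m z)].

(* law of the sum of the squares of k independent N(0,1) variables *)
Definition chi2_cdf (k : nat) (t : R) : R :=
  fine (std_normal k [set z | \sum_(i < k) z i 0 ^+ 2 <= t]).

Definition sup_dist (F H : R -> R) : R := sup (range (fun t => `|F t - H t|)).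

End gaussian.

Section stochastic_order.
Context {R : realType} {d : nat -> measure_display}
  {T : forall n, measurableType (d n)} (P : forall n, probability (T n) R).

Definition bigO_p (Z : forall n, T n -> R) (a : nat -> R) : Prop :=
  forall e : R, 0 < e -> exists C : R,
    \forall n \near \oo, (P n [set w | (C * a n < `|Z n w|)%R] <= e%:E)%E.

Definition littleo_p (Z : forall n, T n -> R) : Prop :=
  forall e : R, 0 < e -> P n [set w | (e < `|Z n w|)%R] @[n --> \oo] --> 0%E.

(* V_n = N(0, Sigma_n) + o_P(1) *)
Definition gaussian_plus_littleo_p (k : nat -> nat)
    (V : forall n, T n -> 'cV[R]_(k n)) (Sigma : forall n, 'M[R]_(k n)) : Prop :=
  exists (xi : forall n, {RV (P n) >-> 'cV[R]_(k n)})
         (r : forall n, T n -> 'cV[R]_(k n)),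
    [/\ forall n, is_gaussian (xi n) (Sigma n),
        forall n w, V n w = xi n w + r n w &
        littleo_p (fun n w => enorm (r n w))].

End stochastic_order.

(* Main.v *)
Require Import Defs.
From HB Require Import structures.
From mathcomp Require Import all_boot all_order all_algebra.
From mathcomp Require Import all_classical all_reals all_analysis.
From mathcomp Require Import measurable_realfun.
From mathcomp Require Import ring lra.

(* On the range of P_G the pseudo-inverse debiases exactly: since |P_G Q_G^perp| < 1,
   the error P_G X_G (b_G - beta_G) equals P_G eps plus the projected bias
   P_G sum_k X_{G_k \ G} (beta - b^init)_{G_k \ G}, which is at most
   sigma max_k (M_k omega'_k / omega_{*,k}) times the weighted group error, hence
   o_P(sigma).  Replacing sigma by its estimate costs |P_G eps| / sigma = O_P(|G|^(1/2))
   times O_P(n^(-1/2) + (s + g log M) / n), again o_P(1).  The limit law of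
   |P_G eps| / sigma is exactly chi with rank(P_G) degrees of freedom, but the rank may
   grow with n, so the convergence of distribution functions needs an
   anticoncentration bound for chi_k that is uniform in k >= 1.

   The Gaussian facts are all consequences of one change of variables, with densities
   relative to the Gaussian measure itself.  Shears give invariance under plane
   rotations, hence under orthogonal maps.  Dilations z -> l z give the exponential
   moments of |z|^2 (Chernoff bounds) and the anticoncentration: about N dilates of a
   thin shell are disjoint and have comparable masses, so each has mass O(1 / N). *)

Set Implicit Arguments.
Unset Strict Implicit.
Unset Printing Implicit Defensive.

Import Order.TTheory GRing.Theory Num.Theory.
Import numFieldNormedType.Exports.

Local Open Scope classical_set_scope.
Local Open Scope ring_scope.

(** The standard normal law is a recursive product, so every Gaussian identity descends by Fubini to
    an affine change of variables on the line, and no Lebesgue measure on the space is involved. The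
    comparison with the chi-square law is made on norms, not on their squares: studentising moves
    |P_G eps| / sigma by an additive o_P(1), whereas the squares can move by an amount growing with
    the rank. The chi law spreads over a length of order 1 for every number of degrees of freedom,
    so one window width serves all ranks. The hypotheses match the errors one by one. The product of
    (s + g log M) / n^(1/2) with (|G| / n)^(1/2) is the relative error of the estimated scale times
    the length |G|^(1/2); its product with the maximum is the projected bias; and |G| / n -> 0 pays
    for the fluctuation of |eps| / n^(1/2) around sigma. At rank 0 the chi law is an atom, but there
    both statistics vanish. *)

(** * Integration against a measure given by a density *)

Section density.
Local Open Scope ereal_scope.
Context d (T : measurableType d) (R : realType).
Variables (mu nu : {measure set T -> \bar R}) (h : T -> R).
Hypothesis mh : measurable_fun [set: T] h.
Hypothesis h0 : forall x, (0 <= h x)%R.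
Hypothesis nuE : forall A, measurable A -> nu A = \int[mu]_(x in A) (h x)%:E.

Import HBNNSimple.

Let density_nnsfun (g : {nnsfun T >-> R}) :
  \int[nu]_x (g x)%:E = \int[mu]_x ((g x)%:E * (h x)%:E).
Proof.
under [LHS]eq_integral do rewrite fimfunE -fsumEFin//.
rewrite [LHS]ge0_integral_fsum//; last 2 first.
  - by move=> r; exact/measurable_EFinP/measurableT_comp.
  - by move=> n x _; rewrite EFinM nnfun_muleindic_ge0.
under [RHS]eq_integral.
  move=> x xD; rewrite fimfunE -fsumEFin// muleC ge0_mule_fsumr; last first.
    by move=> r; rewrite EFinM nnfun_muleindic_ge0.
  over.
rewrite [RHS]ge0_integral_fsum//; last 2 first.
  - move=> r; apply: emeasurable_funM; apply/measurable_EFinP => //.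
    exact/measurableT_comp.
  - by move=> n x _; rewrite mule_ge0 ?lee_fin// -lee_fin EFinM nnfun_muleindic_ge0.
apply: eq_fsbigr => r _.
have [r0|r0] := ltP r 0%R.
  rewrite [g @^-1` _](_ : _ = set0); last first.
    by rewrite -subset0 => x /= gxr; move: r0; rewrite -gxr ltNge fun_ge0.
  rewrite [LHS]integral0_eq ?[RHS]integral0_eq// => x _;
  by rewrite indic0 mulr0 ?mule0.
under [LHS]eq_integral do rewrite EFinM.
rewrite ge0_integralZl//; last exact/measurable_EFinP.
rewrite integral_indic// setIT nuE//.
under [RHS]eq_integral do rewrite EFinM muleCA.
rewrite [RHS]ge0_integralZl//; last 2 first.
- by apply: emeasurable_funM; exact/measurable_EFinP.
- by move=> x _; rewrite mule_ge0// lee_fin.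
congr (_ * _); rewrite integral_mkcond; apply: eq_integral => x _.
by rewrite epatch_indic muleC.
Qed.

Lemma ge0_integral_density (f : T -> \bar R) : measurable_fun [set: T] f ->
  (forall x, 0 <= f x) -> \int[nu]_x f x = \int[mu]_x (f x * (h x)%:E).
Proof.
move=> mf f0; pose f_ := nnsfun_approx measurableT mf.
transitivity (limn (fun n => \int[nu]_x (f_ n x)%:E)).
  rewrite -monotone_convergence//=.
  - apply: eq_integral => x /[!inE] xD; apply/esym/cvg_lim => //=.
    exact: cvg_nnsfun_approx.
  - by move=> n; exact/measurable_EFinP.
  - by move=> n x _; rewrite lee_fin.
  - by move=> x _ a b ab; rewrite lee_fin; exact/lefP/nd_nnsfun_approx.
under eq_fun do rewrite density_nnsfun.
rewrite -monotone_convergence//=.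
- apply: eq_integral => x /[!inE] xD; apply/cvg_lim => //=.
  by apply: cvgeZr => //; exact: cvg_nnsfun_approx.
- by move=> n; apply: emeasurable_funM; exact/measurable_EFinP.
- by move=> n x _; rewrite mule_ge0// lee_fin.
- move=> x _ a b ab; apply: lee_wpmul2r; rewrite lee_fin//.
  exact/lefP/nd_nnsfun_approx.
Qed.
End density.

(** * Affine changes of variables on the line *)

Section lebesgue_affine.
Context {R : realType}.
Local Notation mu := (@lebesgue_measure R).
Implicit Types (a c : R) (f : R -> \bar R).

Lemma measurable_affine a c : measurable_fun [set: R] (fun x => a * x + c).
Proof. by apply: measurable_funD => //; exact: measurable_funM. Qed.

Let affine a c : R -> measurableTypeR R := fun x => a * x + c.

(** Lebesgue measure is determined by its values on half-open intervals, and [a] times the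
    pushforward has these values. A positive slope keeps preimages of []x, y]] half-open on the same
    side; negative slopes are reached through reflection. *)
Let lebesgue_affine_gt0 a c (A : set R) : 0 < a -> measurable A ->
  pushforward mu (affine a c) A = (a^-1%:E * mu A)%E.
Proof.
move=> a0 mA.
have a0' : 0 <= a by exact: ltW.
have [m mE] : exists m : {measure set (measurableTypeR R) -> \bar R},
    forall B, m B = (a%:E * pushforward mu (affine a c) B)%E.
  have maff : measurable_fun [set: R] (affine a c) by exact: measurable_affine.
  by unshelve eexists (mscale (NngNum a0') (pushforward mu (affine a c))).
suff -> : mu A = m A by rewrite mE muleA -EFinM mulVf ?gt_eqF// mul1e.
apply: lebesgue_measure_unique => // _ [[x y]] _ <-.
rewrite mE /pushforward.
rewrite [affine a c @^-1` _](_ : _ = `](x - c) / a, (y - c) / a]%classic); last first.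
  apply/seteqP; split => z /=; rewrite !in_itv/= ltr_pdivrMr// ler_pdivlMr//;
  by rewrite ltrBlDr lerBrDr mulrC.
rewrite !lebesgue_measure_itv/= !lte_fin ltr_pM2r ?invr_gt0//.
rewrite ltrBlDr subrK; case: ifP => _; last by rewrite mule0.
by rewrite -!EFinB -EFinM; congr EFin; field; rewrite gt_eqF.
Qed.

Let ge0_integral_affine_gt0 b c f : 0 < b -> measurable_fun [set: R] f ->
  (forall x, 0 <= f x)%E ->
  (\int[mu]_x f x = b%:E * \int[mu]_x f (b * x + c)%R)%E.
Proof.
move=> b0 mf f0.
have maff : measurable_fun [set: measurableTypeR R]
    (fun x : measurableTypeR R => b * x + c : measurableTypeR R) := measurable_affine b c.
have /= := ge0_integral_pushforward maff mu measurableT mf.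
rewrite preimage_setT => <-; last by move=> x _.
have b0' : 0 <= b^-1 by rewrite invr_ge0 ltW.
transitivity (b%:E * \int[mscale (NngNum b0') mu]_x f x)%E.
  by rewrite ge0_integral_mscale//= muleA -EFinM divff ?gt_eqF// mul1e.
congr (_ * _)%E; apply: eq_measure_integral => A mA _.
exact: esym (lebesgue_affine_gt0 c b0 mA).
Qed.

Let ge0_integral_opp f : measurable_fun [set: R] f -> (forall x, 0 <= f x)%E ->
  (\int[mu]_x f x = \int[mu]_x f (- x)%R)%E.
Proof.
move=> mf f0.
have mN : measurable_fun [set: measurableTypeR R] (-%R : measurableTypeR R -> measurableTypeR R).
  exact: oppr_measurable.
have /= := ge0_integral_pushforward mN mu measurableT mf.
rewrite preimage_setT => <-; last by move=> x _.
by apply: eq_measure_integral => A mA _; exact: esym (lebesgue_measureN mA).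
Qed.

Lemma ge0_integral_affine a c f : a != 0 -> measurable_fun [set: R] f ->
  (forall x, 0 <= f x)%E ->
  (\int[mu]_x f x = `|a|%:E * \int[mu]_x f (a * x + c)%R)%E.
Proof.
move=> a0 mf f0; have [ap|an|a00] := ltrgt0P a.
- exact: ge0_integral_affine_gt0.
- rewrite (@ge0_integral_affine_gt0 (- a) c)// ?oppr_gt0//.
  congr (_ * _)%E; rewrite ge0_integral_opp//; last first.
    by apply: measurableT_comp => //; exact: measurable_affine.
  by apply: eq_integral => x _; rewrite mulrNN.
- by rewrite a00 eqxx in a0.
Qed.

End lebesgue_affine.

(** * Affine changes of variables for the normal law *)

Section normal_affine.
Context {R : realType}.
Local Notation gamma := (@normal_prob R 0 1).

Lemma ge0_integral_normal (f : R -> \bar R) : measurable_fun [set: R] f ->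
  (forall x, 0 <= f x)%E ->
  (\int[gamma]_x f x = \int[lebesgue_measure]_x (f x * (normal_pdf 0 1 x)%:E))%E.
Proof.
move=> mf f0; apply: ge0_integral_density => //.
- exact: measurable_normal_pdf.
- by move=> x; exact: normal_pdf_ge0.
Qed.

Lemma normal_pdf01E (x : R) : normal_pdf 0 1 x =
  normal_peak 1 * expR (- (x ^+ 2 / 2)).
Proof.
rewrite normal_pdfE ?oner_neq0// /normal_fun subr0 expr1n mulNr.
by congr (_ * expR (- (_ / _))); rewrite mulr2n.
Qed.

(** The exponential is the ratio of the normal densities at [a * x + c] and at [x]. With Lebesgue
    measure gone from both sides, the rule can be applied one coordinate at a time in a product of
    normal laws. *)
Lemma normal_affine (a c : R) (f : R -> \bar R) : a != 0 ->
  measurable_fun [set: R] f -> (forall x, 0 <= f x)%E ->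
  (\int[gamma]_x f x = `|a|%:E * \int[gamma]_x
    (f (a * x + c)%R * (expR ((x ^+ 2 - (a * x + c) ^+ 2) / 2))%:E))%E.
Proof.
move=> a0 mf f0.
have mexp : measurable_fun [set: R]
    (fun x => expR ((x ^+ 2 - (a * x + c) ^+ 2) / 2)).
  apply: measurableT_comp => //; apply: measurable_funM => //.
  apply: measurable_funB => //.
  by apply: measurable_funX; exact: measurable_affine.
rewrite ge0_integral_normal// (ge0_integral_affine c a0); first last.
- by move=> x; rewrite mule_ge0// lee_fin normal_pdf_ge0.
- by apply: emeasurable_funM => //; apply/measurable_EFinP; exact: measurable_normal_pdf.
congr (_ * _)%E; rewrite ge0_integral_normal; first last.
- by move=> x; rewrite mule_ge0// lee_fin expR_ge0.
- apply: emeasurable_funM; last exact/measurable_EFinP.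
  by apply: measurableT_comp => //; exact: measurable_affine.
apply: eq_integral => x _; rewrite -muleA; congr (_ * _)%E; rewrite -EFinM.
rewrite !normal_pdf01E mulrCA -expRD; congr (_ * expR _)%:E.
by rewrite mulrBl addrAC subrr add0r.
Qed.

End normal_affine.

(** * Measurability and squared norms of vectors *)

Section measurable_vectors.
Context {R : realType}.

Definition sqnorm n (z : 'cV[R]_n) : R := \sum_(i < n) z i 0 ^+ 2.

Lemma measurable_coord m n (i : 'I_m) (j : 'I_n) :
  measurable_fun [set: 'M[R]_(m, n)] (fun A : 'M[R]_(m, n) => A i j).
Proof.
move=> _ B mB; rewrite setTI; apply: sub_sigma_algebra.
by exists (i, j) => //; exists B => //; rewrite setTI.
Qed.

Lemma measurable_mulmx m n p (A : 'M[R]_(m, n)) :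
  measurable_fun [set: 'M[R]_(n, p)] (fun B : 'M[R]_(n, p) => A *m B).
Proof.
apply: measurable_fun_matrix => i j; under eq_fun do rewrite mxE.
apply: measurable_sum => k; apply: measurable_funM => //.
exact: measurable_coord.
Qed.

Lemma measurable_scalemx m n (a : R) :
  measurable_fun [set: 'M[R]_(m, n)] (fun B : 'M[R]_(m, n) => a *: B).
Proof.
apply: measurable_fun_matrix => i j; under eq_fun do rewrite mxE.
by apply: measurable_funM => //; exact: measurable_coord.
Qed.

Lemma measurable_sqnorm n : measurable_fun [set: 'cV[R]_n] (@sqnorm n).
Proof.
apply: measurable_sum => k; apply: measurable_funX; exact: measurable_coord.
Qed.

Lemma sqnorm_ge0 n (z : 'cV[R]_n) : 0 <= sqnorm z.
Proof. by apply: sumr_ge0 => i _; exact: sqr_ge0. Qed.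

Lemma sqnorm_tr n (z : 'cV[R]_n) : sqnorm z = (z^T *m z) 0 0.
Proof. by rewrite mxE; apply: eq_bigr => i _; rewrite mxE expr2. Qed.

Lemma sqnorm_cons n (x : R) (z : 'cV[R]_n) :
  sqnorm (cons_cV (x, z)) = x ^+ 2 + sqnorm z.
Proof.
rewrite /sqnorm /cons_cV big_ord_recl /=; congr (_ ^+ 2 + _).
  rewrite (_ : ord0 = lshift n (ord0 : 'I_1)); last exact/val_inj.
  by rewrite [LHS]col_mxEu mxE.
apply: eq_bigr => i _; rewrite (_ : lift ord0 i = rshift 1 i); last exact/val_inj.
by rewrite [X in X ^+ 2]col_mxEd.
Qed.

Lemma sqnormZ n a (z : 'cV[R]_n) : sqnorm (a *: z) = a ^+ 2 * sqnorm z.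
Proof. by rewrite /sqnorm mulr_sumr; apply: eq_bigr => i _; rewrite mxE exprMn. Qed.

Lemma enorm_sqr n (z : 'cV[R]_n) : enorm z ^+ 2 = sqnorm z.
Proof. by rewrite sqr_sqrtr// sqnorm_ge0. Qed.

Lemma enorm_ge0 n (z : 'cV[R]_n) : 0 <= enorm z.
Proof. exact: sqrtr_ge0. Qed.

Lemma measurable_enorm n : measurable_fun [set: 'cV[R]_n] (@enorm R n).
Proof.
have ms := continuous_measurable_fun (@sqrt_continuous R).
exact: (measurableT_comp ms (@measurable_sqnorm n)).
Qed.

Lemma cons_cVZ n a (x : R) (z : 'cV[R]_n) : a *: cons_cV (x, z) = cons_cV (a * x, a *: z).
Proof.
apply: (etrans (@scale_col_mx R 1 n 1 _ _ _)); congr col_mx.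
by apply/matrixP => i j; rewrite !mxE.
Qed.

Lemma block_cons_cV m n (O : 'M[R]_(m, n)) (x : R) (z : 'cV[R]_n) :
  (@block_mx R 1 m 1 n 1%:M 0 0 O : 'M[R]_(m.+1, n.+1)) *m cons_cV (x, z) = cons_cV (x, O *m z).
Proof.
apply: (etrans (@mul_block_col R 1 m 1 n 1 _ _ _ _ _ _)); rewrite !mul0mx add0r addr0.
by rewrite mul1mx.
Qed.

End measurable_vectors.

(** * Gaussian integrals: Fubini and dilations *)

Section std_normal_integral.
Context {R : realType}.
Local Notation gamma := (@normal_prob R 0 1).
Local Open Scope ereal_scope.

Lemma ge0_integral_std_normalS n (F : 'cV[R]_n.+1 -> \bar R) :
  measurable_fun [set: 'cV[R]_n.+1] F -> (forall z, 0 <= F z) ->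
  \int[std_normal n.+1]_z F z =
  \int[gamma]_x \int[std_normal n]_z F (cons_cV (x, z)).
Proof.
move=> mF F0.
transitivity (\int[gamma \x std_normal n]_xz F (cons_cV xz)).
  rewrite /= ge0_integral_pushforward//.
rewrite fubini_tonelli1//.
have mc := @measurable_cons_cV R n.
exact: (measurableT_comp mF mc).
Qed.

Lemma ge0_integral_std_normal0 (F : 'cV[R]_0 -> \bar R) :
  measurable_fun [set: 'cV[R]_0] F -> \int[std_normal 0]_z F z = F 0%R.
Proof.
by move=> mF; rewrite /= integral_dirac// diracT mul1e.
Qed.

Lemma measurable_cons_comp n (F : 'cV[R]_n.+1 -> \bar R) (x : R) :
  measurable_fun [set: 'cV[R]_n.+1] F ->
  measurable_fun [set: 'cV[R]_n] (fun z => F (cons_cV (x, z))).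
Proof.
move=> mF; have mc := @measurable_cons_cV R n.
exact: measurableT_comp (measurableT_comp mF mc) (measurable_pair1 _).
Qed.

Lemma measurable_integral_cons n (F : 'cV[R]_n.+1 -> \bar R) :
  measurable_fun [set: 'cV[R]_n.+1] F -> (forall z, 0 <= F z) ->
  measurable_fun [set: R] (fun x => \int[std_normal n]_z F (cons_cV (x, z))).
Proof.
move=> mF F0; have mc := @measurable_cons_cV R n.
have mFc := measurableT_comp mF mc.
exact: (measurable_fun_fubini_tonelli_F (m2 := std_normal n) _ mFc (fun z => F0 _)).
Qed.

Lemma measurable_expR_sqnorm n (a : R) :
  measurable_fun [set: 'cV[R]_n] (fun z => (expR (a * sqnorm z))%:E).
Proof.
apply/measurable_EFinP; apply: measurableT_comp => //.
by apply: measurable_funM => //; exact: measurable_sqnorm.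
Qed.

(* Change of variables [z := l z] in the Gaussian integral, the Lebesgue
   densities having been eliminated. *)
Lemma std_normal_scale (l : R) n (F : 'cV[R]_n -> \bar R) : (0 < l)%R ->
  measurable_fun [set: 'cV[R]_n] F -> (forall z, 0 <= F z) ->
  \int[std_normal n]_z F z = (l ^+ n)%:E * \int[std_normal n]_z
    (F (l *: z)%R * (expR ((1 - l ^+ 2) / 2 * sqnorm z))%:E).
Proof.
move=> l0; elim: n F => [|n IH] F mF F0.
  have E0 : sqnorm (0 : 'cV[R]_0) = 0%R by rewrite /sqnorm big_ord0.
  rewrite !ge0_integral_std_normal0//; last first.
    apply: emeasurable_funM; last exact: measurable_expR_sqnorm.
    exact: (measurableT_comp mF (@measurable_scalemx _ _ _ _)).
  by rewrite scaler0 E0 mulr0 expR0 mule1 mul1e.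
have mFl : measurable_fun [set: 'cV[R]_n.+1]
    (fun z => F (l *: z)%R * (expR ((1 - l ^+ 2) / 2 * sqnorm z))%:E).
  apply: emeasurable_funM; last exact: measurable_expR_sqnorm.
  exact: (measurableT_comp mF (@measurable_scalemx _ _ _ _)).
have Fl0 z : 0 <= F (l *: z)%R * (expR ((1 - l ^+ 2) / 2 * sqnorm z))%:E.
  by rewrite mule_ge0// lee_fin expR_ge0.
rewrite !ge0_integral_std_normalS//.
rewrite (@normal_affine _ l 0)//; [|exact: lt0r_neq0
  |exact: measurable_integral_cons|by move=> x; exact: integral_ge0].
rewrite gtr0_norm// exprS EFinM -muleA; congr (_ * _).
rewrite -ge0_integralZl//; last 3 first.
- exact: (measurable_integral_cons mFl Fl0).
- by move=> x _; apply: integral_ge0 => z _; exact: Fl0.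
- by rewrite lee_fin exprn_ge0// ltW.
apply: eq_integral => x _; rewrite IH; [|exact: measurable_cons_comp|by []].
rewrite -muleA; congr (_ * _).
rewrite -ge0_integralZr//; last 2 first.
- apply: emeasurable_funM; last exact: measurable_expR_sqnorm.
  exact: (measurableT_comp (measurable_cons_comp _ mF)
    (@measurable_scalemx _ _ _ _)).
- by move=> z _; rewrite mule_ge0// lee_fin expR_ge0.
apply: eq_integral => z _; rewrite addr0 cons_cVZ -muleA -EFinM -expRD.
congr (_ * (expR _)%:E); rewrite sqnorm_cons mulrDr addrC; congr (_ + _)%R.
by rewrite exprMn; ring.
Qed.

End std_normal_integral.

(** * Rotation invariance in the plane *)

Section plane_rotation.
Context {R : realType}.
Local Notation gamma := (@normal_prob R 0 1).
Local Notation R' := (measurableTypeR R).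
Local Open Scope ereal_scope.

(* [S] maps the standard Gaussian measure of the plane to a measure with the
   density it would have if [S] preserved the Lebesgue measure. *)
Let unimodular (S : R' * R' -> R' * R') := forall F : R' * R' -> \bar R,
  measurable_fun [set: R' * R'] F -> (forall z, 0 <= F z) ->
  \int[gamma \x gamma]_z F z = \int[gamma \x gamma]_z (F (S z) *
    (expR ((z.1 ^+ 2 + z.2 ^+ 2 - ((S z).1 ^+ 2 + (S z).2 ^+ 2)) / 2))%:E).

Let shear1 t (z : R' * R') : R' * R' := (z.1 + t * z.2, z.2)%R.
Let shear2 t (z : R' * R') : R' * R' := (z.1, z.2 + t * z.1)%R.

Let measurable_shear1 t : measurable_fun [set: R' * R'] (shear1 t).
Proof.
apply: measurable_fun_pair; last exact: measurable_snd.
apply: measurable_funD; first exact: measurable_fst.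
by apply: measurable_funM => //; exact: measurable_snd.
Qed.

Let measurable_shear2 t : measurable_fun [set: R' * R'] (shear2 t).
Proof.
apply: measurable_fun_pair; first exact: measurable_fst.
apply: measurable_funD; first exact: measurable_snd.
by apply: measurable_funM => //; exact: measurable_fst.
Qed.

Let measurable_weight S (F : R' * R' -> \bar R) :
  measurable_fun [set: R' * R'] S -> measurable_fun [set: R' * R'] F ->
  measurable_fun [set: R' * R'] (fun z => F (S z) *
    (expR ((z.1 ^+ 2 + z.2 ^+ 2 - ((S z).1 ^+ 2 + (S z).2 ^+ 2)) / 2))%:E).
Proof.
move=> mS mF; apply: emeasurable_funM; first exact: (measurableT_comp mF mS).
have m1 := measurableT_comp (@measurable_fst _ _ R' R') mS.
have m2 := measurableT_comp (@measurable_snd _ _ R' R') mS.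
apply/measurable_EFinP; apply: measurableT_comp => //.
apply: measurable_funM => //; apply: measurable_funB; apply: measurable_funD;
  apply: measurable_funX => //.
Qed.

Let weight_ge0 S (F : R' * R' -> \bar R) z : (forall z, 0 <= F z) ->
  0 <= F (S z) *
    (expR ((z.1 ^+ 2 + z.2 ^+ 2 - ((S z).1 ^+ 2 + (S z).2 ^+ 2)) / 2))%:E.
Proof. by move=> F0; rewrite mule_ge0// lee_fin expR_ge0. Qed.

(** With the second coordinate frozen, the shear is a translation of the line, whose slope 1 brings
    no Jacobian. *)
Let unimodular_shear1 t : unimodular (shear1 t).
Proof.
move=> F mF F0.
have mFS := measurable_weight (measurable_shear1 t) mF.
have FS0 z := weight_ge0 (shear1 t) z F0.
rewrite !fubini_tonelli2//; apply: eq_integral => y _; rewrite /fubini_G.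
rewrite (@normal_affine _ 1%R (t * y)%R (fun x => F (x, y)))//; last first.
  exact: measurableT_comp mF (measurable_pair2 _).
rewrite normr1 mul1e; apply: eq_integral => x _; rewrite mul1r /shear1/=.
by congr (_ * (expR _)%:E); rewrite opprD addrACA subrr addr0.
Qed.

Let unimodular_shear2 t : unimodular (shear2 t).
Proof.
move=> F mF F0.
have mFS := measurable_weight (measurable_shear2 t) mF.
have FS0 z := weight_ge0 (shear2 t) z F0.
rewrite !fubini_tonelli1//; apply: eq_integral => x _; rewrite /fubini_F.
rewrite (@normal_affine _ 1%R (t * x)%R (fun y => F (x, y)))//; last first.
  exact: measurableT_comp mF (measurable_pair1 _).
rewrite normr1 mul1e; apply: eq_integral => y _; rewrite mul1r /shear2/=.
by congr (_ * (expR _)%:E); rewrite opprD addrACA subrr add0r.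
Qed.

(** The exponents are differences of squared norms, so they telescope along a composition. *)
Let unimodular_comp S S' : measurable_fun [set: R' * R'] S ->
  unimodular S -> unimodular S' -> unimodular (S \o S').
Proof.
move=> mS uS uS' F mF F0; rewrite (uS F mF F0).
rewrite (uS' _ (measurable_weight mS mF) (fun z => weight_ge0 S z F0)).
apply: eq_integral => z _; rewrite -muleA -EFinM -expRD /=.
by congr (_ * (expR _)%:E); rewrite -mulrDl addrC addrA subrK.
Qed.

(* A rotation is the product of three shears. *)
Lemma gaussian_rotation (a b : R) (F : R' * R' -> \bar R) :
  (a ^+ 2 + b ^+ 2 = 1)%R -> b != 0%R ->
  measurable_fun [set: R' * R'] F -> (forall z, 0 <= F z) ->
  \int[gamma \x gamma]_z F z =
  \int[gamma \x gamma]_z F (a * z.1 - b * z.2, b * z.1 + a * z.2)%R.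
Proof.
(* For a rotation of angle theta, [t] is - tan (theta / 2); the division is the reason for excluding
   [b = 0]. *)
move=> ab b0 mF F0; pose t := ((a - 1) / b)%R.
have mS : measurable_fun [set: R' * R'] (shear1 t \o shear2 b).
  exact: measurableT_comp (measurable_shear1 t) (measurable_shear2 b).
rewrite (unimodular_comp mS (unimodular_comp (measurable_shear1 t)
  (unimodular_shear1 t) (unimodular_shear2 b)) (unimodular_shear1 t) mF F0).
apply: eq_integral => -[x y] _ /=.
have tb : (t * b = a - 1)%R by rewrite /t divfK.
have ta : (t * (a + 1) = - b)%R.
  apply: (mulIf b0); rewrite mulrAC tb; lra.
have e2 : (y + b * (x + t * y) = b * x + a * y)%R.
  by rewrite mulrDr mulrA (mulrC b t) tb; ring.
have e1 : (x + t * y + t * (b * x + a * y) = a * x - b * y)%R.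
  by rewrite mulrDr !mulrA tb -[(- (b * y))%R]mulNr -ta; ring.
rewrite /shear1 /shear2 /= e2 e1.
(* The composite preserves the norm, so the remaining weight is 1. *)
rewrite [X in expR (X / 2)](_ : _ = 0%R) ?mul0r ?expR0 ?mule1//.
transitivity ((1 - (a ^+ 2 + b ^+ 2)) * (x ^+ 2 + y ^+ 2))%R; first by ring.
by rewrite ab subrr mul0r.
Qed.

End plane_rotation.

(** * Orthogonal invariance in all dimensions *)

Section orthogonal_invariance.
Context {R : realType}.
Local Notation gamma := (@normal_prob R 0 1).

Lemma cons_cV_surj n (z : 'cV[R]_n.+1) :
  exists x z', z = cons_cV (x, z') :> 'cV[R]_n.+1.
Proof.
exists (z 0 0), (@dsubmx R 1 n 1 z).
apply: (etrans (esym (@vsubmxK R 1 n 1 z))); congr col_mx.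
apply/matrixP => i j; rewrite !mxE !ord1; congr (z _ _); exact/val_inj.
Qed.

Lemma mulmx_cV_inj m n (A B : 'M[R]_(m, n)) :
  (forall z : 'cV[R]_n, A *m z = B *m z) -> A = B.
Proof.
move=> AB; apply/matrixP => i j.
have := AB (delta_mx j 0); rewrite -!colE => /matrixP/(_ i 0).
by rewrite !mxE.
Qed.

Lemma cons_cV0 n : cons_cV (0 : R, 0 : 'cV[R]_n) = 0.
Proof.
rewrite /cons_cV/= (_ : const_mx 0 = 0); first exact: (@col_mx0 R 1 n 1).
by apply/matrixP => i j; rewrite !mxE.
Qed.

Lemma sqnorm_eq0 n (z : 'cV[R]_n) : sqnorm z = 0 -> z = 0.
Proof.
move=> /eqP; rewrite psumr_eq0 => [/allP z0|i _]; last exact: sqr_ge0.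
apply/colP => i; have := z0 i (mem_index_enum _).
by rewrite mxE sqrf_eq0 => /eqP.
Qed.

Definition gaussian_invariant n (U : 'M[R]_n) :=
  forall F : 'cV[R]_n -> \bar R,
  measurable_fun [set: 'cV[R]_n] F -> (forall z, 0 <= F z)%E ->
  (\int[std_normal n]_z F z = \int[std_normal n]_z F (U *m z))%E.

Lemma gaussian_invariant1 n : gaussian_invariant (1%:M : 'M[R]_n).
Proof. by move=> F _ _; apply: eq_integral => z _; rewrite mul1mx. Qed.

Lemma measurable_mulmx_comp m n (O : 'M[R]_(m, n)) (F : 'cV[R]_m -> \bar R) :
  measurable_fun [set: 'cV[R]_m] F ->
  measurable_fun [set: 'cV[R]_n] (fun z => F (O *m z)).
Proof. by move=> mF; exact: (measurableT_comp mF (measurable_mulmx O)). Qed.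

Lemma gaussian_invariantM n (U V : 'M[R]_n) :
  gaussian_invariant U -> gaussian_invariant V -> gaussian_invariant (U *m V).
Proof.
move=> iU iV F mF F0; rewrite iU// iV//; last exact: measurable_mulmx_comp.
by apply: eq_integral => z _; rewrite mulmxA.
Qed.

(** The direct sum of 1 and [O]. The explicit block sizes make [1 + n] and [n.+1], which are
    convertible, match the shape of [cons_cV]. *)
Definition lift_mx m n (O : 'M[R]_(m, n)) : 'M[R]_(m.+1, n.+1) :=
  @block_mx R 1 m 1 n 1%:M 0 0 O.

Lemma lift_mx_cons m n (O : 'M[R]_(m, n)) x z :
  lift_mx O *m cons_cV (x, z) = cons_cV (x, O *m z).
Proof. exact: block_cons_cV. Qed.

Lemma tr_lift_mx m n (O : 'M[R]_(m, n)) : (lift_mx O)^T = lift_mx O^T.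
Proof.
apply: (etrans (@tr_block_mx R 1 m 1 n _ _ _ _)).
by rewrite !trmx0 trmx1.
Qed.

Lemma lift_mxM m n p (O : 'M[R]_(m, n)) (O' : 'M[R]_(n, p)) :
  lift_mx O *m lift_mx O' = lift_mx (O *m O').
Proof.
apply: mulmx_cV_inj => z; have [x [z' ->]] := cons_cV_surj z.
by rewrite -mulmxA !lift_mx_cons mulmxA.
Qed.

Lemma lift_mx1 n : lift_mx (1%:M : 'M[R]_n) = 1%:M.
Proof.
apply: mulmx_cV_inj => z; have [x [z' ->]] := cons_cV_surj z.
by rewrite lift_mx_cons !mul1mx.
Qed.

Let gaussian_invariant_lift n (U : 'M[R]_n) :
  gaussian_invariant U -> gaussian_invariant (lift_mx U).
Proof.
move=> iU F mF F0; rewrite !ge0_integral_std_normalS//; last first.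
  exact: measurable_mulmx_comp.
apply: eq_integral => x _; rewrite iU//; last exact: measurable_cons_comp.
by apply: eq_integral => z _; rewrite lift_mx_cons.
Qed.

Let flip n : 'M[R]_n.+1 := @block_mx R 1 n 1 n (-1)%:M 0 0 1%:M.

Let flip_cons n x (z : 'cV[R]_n) : flip n *m cons_cV (x, z) = cons_cV (- x, z).
Proof.
apply: (etrans (@mul_block_col R 1 n 1 n 1 _ _ _ _ _ _)).
rewrite !mul0mx add0r addr0 mul1mx; congr col_mx.
by apply/matrixP => i j; rewrite mul_scalar_mx !mxE mulN1r.
Qed.

Let flip_orth n : (flip n)^T *m flip n = 1%:M.
Proof.
have -> : (flip n)^T = flip n.
  apply: (etrans (@tr_block_mx R 1 n 1 n _ _ _ _)).
  by rewrite !trmx0 !tr_scalar_mx.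
apply: mulmx_cV_inj => z; have [x [z' ->]] := cons_cV_surj z.
by rewrite -mulmxA !flip_cons opprK mul1mx.
Qed.

Let gaussian_invariant_flip n : gaussian_invariant (flip n).
Proof.
move=> F mF F0; rewrite !ge0_integral_std_normalS//; last first.
  exact: measurable_mulmx_comp.
rewrite (@normal_affine _ (-1) 0)//; last 2 first.
- exact: measurable_integral_cons.
- by move=> x; exact: integral_ge0.
rewrite normrN1 mul1e; apply: eq_integral => x _.
rewrite addr0 mulN1r sqrrN subrr mul0r expR0 mule1.
by apply: eq_integral => z _; rewrite flip_cons.
Qed.

(** Givens rotation: it turns the first two coordinates and fixes the others. *)
Let givens n (a b : R) : 'M[R]_n.+2 :=
  @block_mx R 1 n.+1 1 n.+1 a%:M (@row_mx R 1 1 n (- b)%:M 0)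
    (@col_mx R 1 n 1 b%:M 0) (@block_mx R 1 n 1 n a%:M 0 0 1%:M).

Let givens_cons n a b x y (z : 'cV[R]_n) :
  givens n a b *m cons_cV (x, cons_cV (y, z)) =
  cons_cV (a * x - b * y, cons_cV (b * x + a * y, z)).
Proof.
apply: (etrans (@mul_block_col R 1 n.+1 1 n.+1 1 _ _ _ _ _ _)); congr col_mx.
  rewrite /= [X in _ + X](@mul_row_col R 1 1 n 1).
  apply/matrixP => i j; rewrite mul0mx addr0 !mul_scalar_mx !mxE.
  by rewrite mulNr.
rewrite /= [X in _ + X](@mul_block_col R 1 n 1 n 1).
rewrite [X in X + _](@mul_col_mx R 1 n 1 1).
apply: (etrans (@add_col_mx R 1 n 1 _ _ _ _)).
rewrite !mul0mx mul1mx !addr0 !add0r; congr col_mx.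
by apply/matrixP => i j; rewrite !mul_scalar_mx !mxE.
Qed.

Let givens_orth n a b : a ^+ 2 + b ^+ 2 = 1 ->
  (givens n a b)^T *m givens n a b = 1%:M.
Proof.
move=> ab; have -> : (givens n a b)^T = givens n a (- b).
  apply: (etrans (@tr_block_mx R 1 n.+1 1 n.+1 _ _ _ _)).
  rewrite (@tr_block_mx R 1 n 1 n) (@tr_row_mx R 1 1 n) (@tr_col_mx R 1 n 1).
  by rewrite !trmx0 !tr_scalar_mx /givens opprK.
apply: mulmx_cV_inj => z; have [x [z1 ->]] := cons_cV_surj z.
have [y [z2 ->]] := cons_cV_surj z1.
rewrite -mulmxA !givens_cons mul1mx; congr (cons_cV (_, cons_cV (_, _))).
  by transitivity ((a ^+ 2 + b ^+ 2) * x); [ring|rewrite ab mul1r].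
by transitivity ((a ^+ 2 + b ^+ 2) * y); [ring|rewrite ab mul1r].
Qed.

Let gaussian_invariant_givens n a b : a ^+ 2 + b ^+ 2 = 1 -> b != 0 ->
  gaussian_invariant (givens n a b).
Proof.
move=> ab b0.
have mF2 F : measurable_fun [set: 'cV[R]_n.+2] F -> (forall z, 0 <= F z)%E ->
    measurable_fun [set: measurableTypeR R * measurableTypeR R] (fun xy =>
      \int[std_normal n]_z F (cons_cV (xy.1, cons_cV (xy.2, z))))%E.
  move=> mF F0.
  pose c (u : measurableTypeR R * measurableTypeR R * 'cV[R]_n) : 'cV[R]_n.+2 :=
    cons_cV (u.1.1, cons_cV (u.1.2, u.2)).
  have mc : measurable_fun
      [set: measurableTypeR R * measurableTypeR R * 'cV[R]_n] c.
    apply: (measurableT_comp (@measurable_cons_cV R n.+1)).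
    apply: measurable_fun_pair.
      exact: measurableT_comp measurable_fst measurable_fst.
    apply: (measurableT_comp (@measurable_cons_cV R n)).
    apply: measurable_fun_pair; last exact: measurable_snd.
    exact: measurableT_comp measurable_snd measurable_fst.
  have mFc := measurableT_comp mF mc.
  exact: (measurable_fun_fubini_tonelli_F (m2 := std_normal n) _ mFc
    (fun u => F0 _)).
have std2 F : measurable_fun [set: 'cV[R]_n.+2] F -> (forall z, 0 <= F z)%E ->
    (\int[std_normal n.+2]_z F z = \int[gamma \x gamma]_xy
     \int[std_normal n]_z F (cons_cV (xy.1, cons_cV (xy.2, z))))%E.
  move=> mF F0; rewrite ge0_integral_std_normalS//.
  rewrite fubini_tonelli1//; first last.
  - by move=> xy; exact: integral_ge0.
  - exact: mF2.
  apply: eq_integral => x _; rewrite ge0_integral_std_normalS//.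
  exact: measurable_cons_comp.
move=> F mF F0; rewrite !std2//; last exact: measurable_mulmx_comp.
rewrite (gaussian_rotation ab b0)//; last 2 first.
- exact: mF2.
- by move=> xy; exact: integral_ge0.
by apply: eq_integral => xy _; apply: eq_integral => z _; rewrite givens_cons.
Qed.

(** By induction the tail of [v] is brought onto its own first axis, after which one Givens rotation
    merges the two coordinates that remain. If the tail is 0, no rotation with [b != 0] is at hand,
    but [v] is plus or minus the target and the identity or a sign flip suffices. *)
Lemma gaussian_invariant_e0 n (v : 'cV[R]_n.+1) : sqnorm v = 1 ->
  exists U : 'M[R]_n.+1, [/\ gaussian_invariant U, U^T *m U = 1%:M &
    U *m v = cons_cV (1, 0)].
Proof.
have base m (x : R) : sqnorm (cons_cV (x, 0 : 'cV[R]_m)) = 1 ->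
    exists U : 'M[R]_m.+1, [/\ gaussian_invariant U, U^T *m U = 1%:M &
    U *m cons_cV (x, 0) = cons_cV (1, 0)].
  rewrite sqnorm_cons /sqnorm big1 ?addr0; last by move=> i _; rewrite mxE expr0n.
  move=> /eqP; rewrite sqrf_eq1 => /orP[] /eqP ->.
    exists 1%:M; split; first exact: gaussian_invariant1.
      by rewrite trmx1 mul1mx.
    by rewrite mul1mx.
  exists (flip m); split; [exact: gaussian_invariant_flip|exact: flip_orth|].
  by rewrite flip_cons opprK.
elim: n v => [|n IH] v; have [x [z ->]] := cons_cV_surj v.
  by rewrite (flatmx0 z); exact: base.
have [->|z0] := eqVneq z 0; first exact: base.
pose r := enorm z; have r2 : r ^+ 2 = sqnorm z by exact: enorm_sqr.
have r0 : r != 0.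
  by apply: contra_neq z0 => r0; apply: sqnorm_eq0; rewrite -r2 r0 expr0n.
rewrite sqnorm_cons -r2 => xr.
have [|U [iU oU Uz]] := IH (r^-1 *: z).
  by rewrite sqnormZ -r2 exprVn mulVf// expf_neq0.
have {}Uz : U *m z = cons_cV (r, 0).
  rewrite -[z]scale1r -(divff r0) -scalerA -scalemxAr Uz cons_cVZ.
  by rewrite mulr1 scaler0.
have xr' : x ^+ 2 + (- r) ^+ 2 = 1 by rewrite sqrrN.
(* With [a = x] and [b = - r] the pair (x, r) goes to (x^2 + r^2, 0) = (1, 0). *)
exists (givens n x (- r) *m lift_mx U); split.
- apply: gaussian_invariantM; last exact: gaussian_invariant_lift.
  by apply: gaussian_invariant_givens => //; rewrite oppr_eq0.
- rewrite trmx_mul mulmxA -(mulmxA _ _ (givens _ _ _)) givens_orth// mulmx1.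
  by rewrite tr_lift_mx lift_mxM oU lift_mx1.
- rewrite -mulmxA lift_mx_cons Uz givens_cons.
  rewrite mulNr opprK -!expr2 xr mulNr (mulrC x) addNr.
  by congr (cons_cV (_, _)); exact: cons_cV0.
Qed.

(** Only the rows of [O] are orthonormal, so rotations and marginals are treated together. Rotating
    the first row of [O] onto the first axis leaves a matrix [W] which orthonormality forces to be
    [lift_mx W']; Fubini then reduces the claim to [W']. *)
Lemma std_normal_orth k m (O : 'M[R]_(k, m)) (F : 'cV[R]_k -> \bar R) :
  O *m O^T = 1%:M ->
  measurable_fun [set: 'cV[R]_k] F -> (forall z, 0 <= F z)%E ->
  (\int[std_normal m]_z F (O *m z) = \int[std_normal k]_z F z)%E.
Proof.
elim: k m O F => [|k IH] m O F OO mF F0.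
  rewrite ge0_integral_std_normal0//.
  under eq_integral do rewrite (flatmx0 (O *m _)).
  rewrite integral_cst// [X in (_ * X)%E](_ : _ = 1%E) ?mule1//; exact: probability_setT.
case: m O OO => [|m] O OO.
  have /matrixP/(_ 0 0) := OO.
  rewrite !mxE big_ord0 => /esym/eqP; by rewrite oner_eq0.
pose v := (row 0 O)^T.
have v1 : sqnorm v = 1.
  transitivity ((O *m O^T) 0 0); last by rewrite OO mxE eqxx.
  by rewrite mxE; apply: eq_bigr => i _; rewrite !mxE expr2.
have [U [iU oU Uv]] := gaussian_invariant_e0 v1.
pose W := O *m U^T.
have OE : O = W *m U by rewrite /W -mulmxA oU mulmx1.
have WW : W *m W^T = 1%:M.
  by rewrite /W trmx_mul trmxK mulmxA -(mulmxA O) oU mulmx1.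
have W0 : row 0 W = (cons_cV (1, 0 : 'cV[R]_m))^T.
  by rewrite -Uv /W row_mul trmx_mul trmxK.
have [W' WE] : exists W' : 'M[R]_(k, m), W = lift_mx W'.
  have W0' : @usubmx R 1 k m.+1 W = @row_mx R 1 1 m 1%:M 0.
    transitivity (row 0 W).
      apply/matrixP => i j; rewrite mxE [RHS]mxE.
      by apply: (f_equal2 (fun a b => W a b)); rewrite // !ord1; exact/val_inj.
    rewrite W0; apply: (etrans (@tr_col_mx R 1 m 1 _ _)); rewrite trmx0.
    by congr (@row_mx R 1 1 m _ _); apply/matrixP => i j; rewrite !mxE !ord1.
  have A1 : @ulsubmx R 1 k 1 m W = 1%:M.
    by rewrite /ulsubmx W0'; exact: (@row_mxKl R 1 1 m).
  have B0 : @ursubmx R 1 k 1 m W = 0.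
    by rewrite /ursubmx W0'; exact: (@row_mxKr R 1 1 m).
  exists (@drsubmx R 1 k 1 m W).
  have WE : W = @block_mx R 1 k 1 m 1%:M 0 (@dlsubmx R 1 k 1 m W)
      (@drsubmx R 1 k 1 m W).
    by rewrite -A1 -B0; exact: esym (@submxK R 1 k 1 m W).
  (* As the first row of [W] is (1, 0), the lower left block of [W *m W^T] is that of [W] itself. *)
  suff C0 : @dlsubmx R 1 k 1 m W = 0 by rewrite {1}WE C0.
  have := congr1 (@dlsubmx R 1 k 1 k) WW; rewrite {1 2}WE.
  rewrite (@tr_block_mx R 1 k 1 m) (@mulmx_block R 1 k 1 m 1 k).
  rewrite (@block_mxKdl R 1 k 1 k) trmx1 trmx0 mulmx1 mulmx0 addr0 => ->.
  by rewrite (@scalar_mx_block R 1 k) (@block_mxKdl R 1 k 1 k).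
have W'W' : W' *m W'^T = 1%:M.
  apply: mulmx_cV_inj => z; have := WW.
  rewrite WE tr_lift_mx lift_mxM => /(congr1 (mulmx^~ (cons_cV (0, z)))).
  rewrite /= lift_mx_cons !mul1mx => /(congr1 (@dsubmx R 1 k 1)).
  by rewrite /cons_cV /= !(@col_mxKd R 1 k 1).
transitivity (\int[std_normal m.+1]_z F (W *m z))%E.
  rewrite (iU (fun z => F (W *m z)))//; last exact: measurable_mulmx_comp.
  by apply: eq_integral => z _; rewrite mulmxA -OE.
rewrite !ge0_integral_std_normalS//; last exact: measurable_mulmx_comp.
apply: eq_integral => x _; under eq_integral do rewrite WE lift_mx_cons.
by apply: (IH m W' (fun z => F (cons_cV (x, z)))) => //; exact: measurable_cons_comp.
Qed.
End orthogonal_invariance.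

(** * An elementary bound on the exponential *)

Section expR_bound.
Context {R : realType}.

(** For such w, exp w is at most 1 / (1 - w), and (1 - w)(1 + w + 2 w^2) = 1 + w^2 (1 - 2 w) is at
    least 1. *)
Lemma expR_le_quadratic (w : R) : w <= 1 / 2 -> expR w <= 1 + w + 2 * w ^+ 2.
Proof.
move=> w2; have w1 : 0 < 1 - w by lra.
have : 1 - w <= expR (- w) by rewrite -[1 - w]/(1 + - w) expR_ge1Dx.
rewrite expRN -[leRHS]div1r ler_pdivlMr ?expR_gt0// => h.
rewrite -(ler_pM2l w1) (le_trans h)//.
have -> : (1 - w) * (1 + w + 2 * w ^+ 2) = 1 + w ^+ 2 * (1 - 2 * w) by ring.
by rewrite lerDl mulr_ge0 ?sqr_ge0//; lra.
Qed.

End expR_bound.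

(** * Chi-square tails, small balls and anticoncentration *)

Section chi_square.
Context {R : realType}.
Implicit Types (k n : nat).

Lemma measurable_sqnorm_le k (a : R) :
  measurable [set z : 'cV[R]_k | sqnorm z <= a].
Proof.
rewrite [X in measurable X](_ : _ = @sqnorm R k @^-1` `]-oo, a]); last first.
  by apply/seteqP; split => z; rewrite /= in_itv.
by rewrite -[X in measurable X]setTI; apply: measurable_sqnorm.
Qed.

Lemma measurable_sqnorm_gt k (a : R) :
  measurable [set z : 'cV[R]_k | a < sqnorm z].
Proof.
rewrite [X in measurable X](_ : _ = @sqnorm R k @^-1` `]a, +oo[); last first.
  by apply/seteqP; split => z; rewrite /= in_itv/= andbT.
by rewrite -[X in measurable X]setTI; apply: measurable_sqnorm.
Qed.

Lemma measurable_sqnorm_itv k (a b : R) :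
  measurable [set z : 'cV[R]_k | a < sqnorm z <= b].
Proof.
rewrite [X in measurable X](_ : _ = @sqnorm R k @^-1` `]a, b]); last first.
  by apply/seteqP; split => z; rewrite /= in_itv.
by rewrite -[X in measurable X]setTI; apply: measurable_sqnorm.
Qed.

Lemma measurable_sqnorm_dist k (a b : R) :
  measurable [set z : 'cV[R]_k | a < `|sqnorm z - b|].
Proof.
have mf : measurable_fun [set: 'cV[R]_k] (fun z => `|sqnorm z - b|).
  apply: (measurableT_comp (@normr_measurable R setT)).
  by apply: measurable_funB => //; exact: measurable_sqnorm.
rewrite [X in measurable X](_ : _ = (fun z => `|sqnorm z - b|) @^-1` `]a, +oo[).
  by rewrite -[X in measurable X]setTI; apply: mf.
by apply/seteqP; split => z; rewrite /= in_itv/= andbT.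
Qed.

(** The last assumption bounds from below, on the preimage of [A], the Gaussian density of the
    dilation by [l]. Small balls and thin shells are both compared with their dilates in this
    way. *)
Lemma std_normal_scale_ge k (l c : R) (A : set 'cV[R]_k) : 0 < l -> 0 <= c ->
  measurable A ->
  (forall z, A (l *: z) -> c <= l ^+ k * expR ((1 - l ^+ 2) / 2 * sqnorm z)) ->
  (c%:E * std_normal k [set z | A (l *: z)] <= std_normal k A)%E.
Proof.
move=> l0 c0 mA Ac.
have mAl : measurable [set z : 'cV[R]_k | A (l *: z)].
  have := @measurable_scalemx R k 1 l.
  by move=> /(_ measurableT _ mA); rewrite setTI.
rewrite -[X in (_ <= std_normal k X)%E]setIT -integral_indic//.
rewrite (std_normal_scale (l := l))//; last first.
  exact/measurable_EFinP.
rewrite -[X in std_normal k X]setIT -integral_indic//.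
have ml := @measurable_expR_sqnorm R k ((1 - l ^+ 2) / 2).
have mi : measurable_fun [set: 'cV[R]_k]
    (fun z => (\1_A (l *: z) : R)%:E * (expR ((1 - l ^+ 2) / 2 * sqnorm z))%:E)%E.
  apply: emeasurable_funM => //; apply/measurable_EFinP.
  have m1 : measurable_fun [set: 'cV[R]_k] (\1_A : _ -> R) by [].
  exact: (measurableT_comp m1 (@measurable_scalemx R k 1 l)).
have mi1 : measurable_fun [set: 'cV[R]_k]
    (fun z => (\1_[set z | A (l *: z)] z : R)%:E) by exact/measurable_EFinP.
have ln0 : (0 <= (l ^+ k)%:E)%E by rewrite lee_fin exprn_ge0// ltW.
rewrite -[leLHS]ge0_integralZl// -[leRHS]ge0_integralZl//.
apply: ge0_le_integral => //.
- by move=> z _; rewrite mule_ge0// lee_fin.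
- exact: emeasurable_funM.
- exact: emeasurable_funM.
move=> z _; rewrite !indicE; have [Az|nAz] := pselect (A (l *: z)).
  by rewrite !mem_set//= mule1 mul1e -EFinM lee_fin Ac.
by rewrite !memNset//= mule0 mul0e mule0.
Qed.

(** The dilation formula for the constant function 1, solved for the integral. *)
Lemma integral_expR_sqnorm n (l : R) : 0 < l ->
  (\int[std_normal n]_z (expR ((1 - l ^+ 2) / 2 * sqnorm z))%:E =
   (l ^- n)%:E)%E.
Proof.
move=> l0.
have := @std_normal_scale R l n (cst 1%E) l0 (measurable_cst _) (fun=> lee01).
rewrite integral_cst// [X in (_ * X)%E]probability_setT mule1.
under eq_integral do rewrite mul1e.
set I := (\int[_]_z _)%E => E.
have ln0 : l ^+ n != 0 by rewrite expf_neq0// gt_eqF.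
by rewrite -[LHS]mul1e -(mulVf ln0) EFinM -muleA -E mule1.
Qed.

(* The exponential moment of the chi-square law at [s = (1 - l^2) / 2], with
   [l = exp(-v)]. *)
Lemma std_normal_chernoff n (v b : R) (A : set 'cV[R]_n) : measurable A ->
  (forall z, A z -> b <= (1 - expR (- v) ^+ 2) / 2 * sqnorm z) ->
  (std_normal n A <= (expR (n%:R * v - b))%:E)%E.
Proof.
move=> mA Ab; pose f := (fun z : 'cV[R]_n => expR ((1 - expR (- v) ^+ 2) / 2 * sqnorm z)).
have mf : measurable_fun [set: 'cV[R]_n] (fun z => (f z)%:E) := @measurable_expR_sqnorm R n _.
rewrite -[X in std_normal n X]setIT -integral_indic//.
apply: (@le_trans _ _ (\int[std_normal n]_z ((expR (- b))%:E * (f z)%:E))%E).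
  apply: ge0_le_integral => //.
  - exact/measurable_EFinP.
  - exact: (emeasurable_funM (measurable_cst _) mf).
  move=> z _; rewrite indicE -EFinM lee_fin -expRD.
  have [Az|nAz] := pselect (A z); last by rewrite memNset ?expR_ge0.
  by rewrite mem_set//= -[leLHS]expR0 ler_expR addrC subr_ge0; exact: Ab.
rewrite ge0_integralZl//; last by move=> z _; rewrite lee_fin expR_ge0.
rewrite (integral_expR_sqnorm n (expR_gt0 (- v))).
by rewrite -EFinM lee_fin -expRM_natl -expRN -expRD ler_expR mulrN opprK addrC.
Qed.

(** The quadratic bound at - 2 v. Since [v] may have either sign, it serves both Chernoff tails and
    the dilations in both directions. *)
Lemma expR_sqr_ge (v : R) : - (1 / 4) <= v ->
  v - 4 * v ^+ 2 <= (1 - expR (- v) ^+ 2) / 2.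
Proof.
move=> v4; have /expR_le_quadratic : - (2 * v) <= 1 / 2 by lra.
rewrite -expRM_natl (_ : 2%:R * - v = - (2 * v)); last by rewrite mulrN.
rewrite sqrrN exprMn; set E := expR _; set w := v ^+ 2; lra.
Qed.

Lemma expR_maxN_ln_le (e : R) : 0 < e -> expR (- Num.max 0 (- ln e)) <= e.
Proof.
by move=> e0; rewrite -[leRHS]lnK// ler_expR lerNl le_max lexx orbT.
Qed.

(** Chernoff with v = 1/r and v = - 1/r, where r = n^(1/2), yields the exponents 4 - C + 4 C/r and 4
    - C - 4 C/r. From n >= 64 comes r >= 8, hence 4 C/r <= C/2, and C = 8 + 2 u makes both at most -
    u. *)
Lemma chi_square_concentration (e : R) : 0 < e -> exists2 C : R, 0 < C &
  forall n, (64 <= n)%N ->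
  (std_normal n [set z | (C * Num.sqrt n%:R < `|sqnorm z - n%:R|)%R] <= e%:E)%E.
Proof.
move=> e0; set u := Num.max 0 (- ln (e / 2)).
have u0 : 0 <= u by rewrite le_max lexx.
have ue : expR (- u) <= e / 2 by apply: expR_maxN_ln_le; rewrite divr_gt0.
exists (8 + 2 * u); first lra.
move=> n n64; set C := 8 + 2 * u; set r := Num.sqrt n%:R.
have nr : n%:R = r ^+ 2 by rewrite sqr_sqrtr.
have r8 : 8 <= r.
  rewrite -[leLHS]ger0_norm// -sqrtr_sqr ler_sqrt ?ler0n//.
  by rewrite -natrX ler_nat.
have r0 : 0 < r by lra.
have C0 : 0 <= C by rewrite /C; lra.
have Cr0 : 0 <= C / r by exact: divr_ge0 C0 (ltW r0).
have Cr8 : C / r <= C / 8 by rewrite ler_wpM2l// lef_pV2// posrE.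
pose A1 := [set z : 'cV[R]_n | n%:R + C * r < sqnorm z].
pose A2 := [set z : 'cV[R]_n | sqnorm z <= n%:R - C * r].
have mA1 : measurable A1 by exact: measurable_sqnorm_gt.
have mA2 : measurable A2 by exact: measurable_sqnorm_le.
have rv : r^-1 * r = 1 by rewrite mulVf// gt_eqF.
have v8 : r^-1 <= 1 / 8 by rewrite div1r lef_pV2// posrE.
have v0 : 0 <= r^-1 by rewrite invr_ge0 ltW.
have P1 : (std_normal n A1 <= (e / 2)%:E)%E.
  apply: (le_trans (@std_normal_chernoff n r^-1
    ((r^-1 - 4 * r^-1 ^+ 2) * (n%:R + C * r)) A1 mA1 _)).
    move=> z Az; apply: (@le_trans _ _ ((r^-1 - 4 * r^-1 ^+ 2) * sqnorm z)).
      rewrite ler_wpM2l ?ltW//; nra.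
    by rewrite ler_wpM2r ?sqnorm_ge0// expR_sqr_ge//; lra.
  rewrite lee_fin (le_trans _ ue)// ler_expR nr.
  have -> : r ^+ 2 * r^-1 - (r^-1 - 4 * r^-1 ^+ 2) * (r ^+ 2 + C * r) =
      4 - C + 4 * (C / r) by field; rewrite gt_eqF.
  rewrite /C in Cr8 *; lra.
have P2 : (std_normal n A2 <= (e / 2)%:E)%E.
  apply: (le_trans (@std_normal_chernoff n (- r^-1)
    ((- r^-1 - 4 * r^-1 ^+ 2) * (n%:R - C * r)) A2 mA2 _)).
    move=> z Az; apply: (@le_trans _ _ ((- r^-1 - 4 * r^-1 ^+ 2) * sqnorm z)).
      rewrite ler_wnM2l//; nra.
    rewrite ler_wpM2r ?sqnorm_ge0// -[in X in 4 * X](sqrrN r^-1) expR_sqr_ge//.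
    by lra.
  rewrite lee_fin (le_trans _ ue)// ler_expR nr.
  have -> : r ^+ 2 * - r^-1 - (- r^-1 - 4 * r^-1 ^+ 2) * (r ^+ 2 - C * r) =
      4 - C - 4 * (C / r) by field; rewrite gt_eqF.
  rewrite /C in Cr0 *; lra.
apply: (@le_trans _ _ (std_normal n (A1 `|` A2))).
  apply: le_measure; rewrite ?inE.
  - exact: measurable_sqnorm_dist.
  - exact: measurableU.
  move=> z /=; rewrite /A1 /A2 /= -/C -/r; have [h|h] := leP n%:R (sqnorm z).
    by rewrite ger0_norm ?subr_ge0// => h1; left; lra.
  by rewrite ltr0_norm ?subr_lt0// => h1; right; lra.
apply: (le_trans (measureU2 _ mA1 mA2)).
by rewrite [e]splitr EFinD leeD.
Qed.

(** Chernoff at v = 1/16, where v - 4 v^2 = 3/64; [C] is the constant that makes the exponent - k u.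
    This is at most - u once k >= 1, and for k = 0 the set is empty. *)
Lemma chi_square_tail (e : R) : 0 < e -> exists2 C : R, 0 < C &
  forall k, (std_normal k [set z | (C * k%:R < sqnorm z)%R] <= e%:E)%E.
Proof.
move=> e0; set u := Num.max 0 (- ln e).
have u0 : 0 <= u by rewrite le_max lexx.
have ue : expR (- u) <= e by exact: expR_maxN_ln_le.
exists ((4 + 64 * u) / 3); first lra.
move=> k; set C := (4 + 64 * u) / 3.
case: k => [|k].
  rewrite [X in std_normal _ X](_ : _ = set0) ?measure0 ?lee_fin ?ltW//.
  by apply/seteqP; split => z //=; rewrite mulr0 /sqnorm big_ord0 ltxx.
apply: (le_trans (@std_normal_chernoff k.+1 (1 / 16)
  ((1 / 16 - 4 * (1 / 16) ^+ 2) * (C * k.+1%:R)) _ (measurable_sqnorm_gt _) _)).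
  move=> z /= Az; apply: (@le_trans _ _ ((1 / 16 - 4 * (1 / 16) ^+ 2) * sqnorm z)).
    by rewrite ler_wpM2l ?ltW//; lra.
  by rewrite ler_wpM2r ?sqnorm_ge0// expR_sqr_ge//; lra.
rewrite lee_fin (le_trans _ ue)// ler_expR.
have k1 : 1 <= k.+1%:R :> R by rewrite ler1n.
have -> : k.+1%:R * (1 / 16) - (1 / 16 - 4 * (1 / 16) ^+ 2) * (C * k.+1%:R) =
  - (k.+1%:R * u) by rewrite /C; field.
by rewrite lerN2 ler_peMl.
Qed.

(** Dilating by 1/r carries the ball onto the unit ball, of mass at most 1. On the small ball the
    density of the dilation is at least r^(-k) exp (- 1/2), and r^(-k) >= 1/r because k >= 1. *)
Lemma chi_square_small_ball k (r : R) : (0 < k)%N -> 0 < r -> r <= 1 ->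
  (std_normal k [set z | (sqnorm z <= r ^+ 2)%R] <= (r * expR (1 / 2))%:E)%E.
Proof.
move=> k0 r0 r1; set c := r^-1 * expR (- (1 / 2)).
have c0 : 0 < c by rewrite mulr_gt0 ?invr_gt0 ?expR_gt0.
have rV1 : 1 <= r^-1 by rewrite -[leLHS]invr1 lef_pV2 ?posrE.
have -> : r * expR (1 / 2) = c^-1 by rewrite /c invfM invrK expRN invrK.
rewrite -[leRHS]mule1 lee_pdivlMl//.
have rE (z : 'cV[R]_k) : (sqnorm (r^-1 *: z) <= 1) = (sqnorm z <= r ^+ 2).
  by rewrite sqnormZ exprVn mulrC ler_pdivrMr ?exprn_gt0// mul1r.
rewrite -[X in std_normal k X](_ : [set z | [set z | sqnorm z <= 1] (r^-1 *: z)] = _);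
  last by apply/seteqP; split => z /=; rewrite rE.
apply: le_trans (probability_le1 (std_normal k) (measurable_sqnorm_le 1)).
apply: std_normal_scale_ge; [by rewrite invr_gt0|exact: ltW
  |exact: measurable_sqnorm_le|move=> z /=; rewrite rE => zr].
rewrite /c ler_pM ?invr_ge0 ?(ltW r0) ?expR_ge0//.
  by rewrite -[leLHS]expr1 ler_weXn2l.
rewrite ler_expR.
have rr : r^-1 ^+ 2 * r ^+ 2 = 1 by rewrite -exprMn mulVf ?expr1n// gt_eqF.
have r2 : 0 <= r^-1 ^+ 2 by rewrite sqr_ge0.
have : r^-1 ^+ 2 * sqnorm z <= r^-1 ^+ 2 * r ^+ 2 by rewrite ler_wpM2l.
rewrite rr mulrAC; have := sqnorm_ge0 z; nra.
Qed.

(** The dilates of the shell by exp (j t) or exp (- j t), for j < N, are disjoint, and each keeps at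
    least the fraction exp (- 1) of its mass; their total is at most 1. *)
Lemma chi_square_shell k N (t a b : R) : 0 <= a -> b <= expR t ^+ 2 * a ->
  0 <= t -> N%:R * t <= 1 / 4 -> 4 * b * (N%:R * t) ^+ 2 <= 1 ->
  (b <= k%:R) || (k%:R <= a) ->
  (N%:R%:E * std_normal k [set z | (a < sqnorm z <= b)%R] <= (expR 1)%:E)%E.
Proof.
move=> a0 bta t0 Nt bNt bka.
(* Move outwards when the shell lies below squared radius [k] and inwards when it lies above:
   towards the bulk of the law, so that the mass does not collapse. *)
pose sg : R := if b <= k%:R then 1 else -1.
pose l j : R := expR (sg * (j%:R * t)).
have l0 j : 0 < l j by exact: expR_gt0.
pose A j := [set z : 'cV[R]_k | l j ^+ 2 * a < sqnorm z <= l j ^+ 2 * b].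
have mA j : measurable (A j) by exact: measurable_sqnorm_itv.
(* Since b <= exp (2 t) a, a single step of the dilation already clears the shell. *)
have lb i j : (i < j)%N -> (l i ^+ 2 * b <= l j ^+ 2 * a) \/
    (l j ^+ 2 * b <= l i ^+ 2 * a).
  move=> ij; have ijt : i%:R * t + t <= j%:R * t.
    by rewrite -[X in _ + X]mul1r -mulrDl ler_wpM2r// natr1 ler_nat.
  have lS p q : expR t * l p <= l q -> l p ^+ 2 * b <= l q ^+ 2 * a.
    move=> lpq; apply: (@le_trans _ _ (l p ^+ 2 * (expR t ^+ 2 * a))).
      by rewrite ler_wpM2l ?sqr_ge0.
    rewrite mulrA -exprMn mulrC (mulrC (l p)) mulrC ler_wpM2r//.
    by rewrite lerXn2r ?nnegrE ?mulr_ge0 ?expR_ge0// ltW.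
  rewrite /l /sg in lS *; case: ifP lS => _ lS; [left|right]; apply: lS;
    by rewrite -expRD ler_expR; lra.
have tA : trivIset setT A.
  move=> i j _ _ [z [/andP[iz1 iz2] /andP[jz1 jz2]]].
  case: (ltngtP i j) => // /lb [h|h]; exfalso.
  - by have := le_lt_trans (le_trans iz2 h) jz1; rewrite ltxx.
  - by have := le_lt_trans (le_trans jz2 h) iz1; rewrite ltxx.
  - by have := le_lt_trans (le_trans jz2 h) iz1; rewrite ltxx.
  - by have := le_lt_trans (le_trans iz2 h) jz1; rewrite ltxx.
have PA j : (j < N)%N -> ((expR (- 1)%R)%:E *
    std_normal k [set z | (a < sqnorm z <= b)%R] <= std_normal k (A j))%E.
  move=> jN.
  have AE z : A j (l j *: z) = (a < sqnorm z <= b).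
    by rewrite /A /= sqnormZ ltr_pM2l ?ler_pM2l ?exprn_gt0.
  rewrite [X in std_normal k X](_ : _ = [set z | A j (l j *: z)]); last first.
    by apply/seteqP; split => z; rewrite /= AE.
  apply: std_normal_scale_ge; [exact: l0|exact: expR_ge0|exact: mA|].
  move=> z; rewrite AE => /andP[az zb].
  (* The logarithm of the density is at least (k - |z|^2) w - 4 |z|^2 w^2. The first term is
     nonnegative by the choice of [sg], the second at least - 1 by the assumption on
     [4 * b * (N%:R * t) ^+ 2]. *)
  set w := sg * (j%:R * t).
  have jt0 : 0 <= j%:R * t by rewrite mulr_ge0.
  have jt : j%:R * t <= N%:R * t by rewrite ler_wpM2r// ler_nat ltnW.
  have w2 : w ^+ 2 = (j%:R * t) ^+ 2.
    by rewrite exprMn /sg; case: ifP => _; rewrite ?sqrrN expr1n mul1r.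
  have wk : 0 <= (k%:R - sqnorm z) * w.
    rewrite /w /sg; case: ifPn bka => /= [bk _|_ ka].
      by rewrite mul1r mulr_ge0// subr_ge0 (le_trans zb).
    by rewrite mulN1r mulrN -mulNr mulr_ge0// opprB subr_ge0 (le_trans ka) ?ltW.
  have w4 : - (1 / 4) <= - w.
    by rewrite lerN2 /w /sg; case: ifP => _; lra.
  have := expR_sqr_ge w4; rewrite sqrrN opprK -/(l j) => /(ler_wpM2r (sqnorm_ge0 z)).
  have qw : 4 * sqnorm z * w ^+ 2 <= 1.
    apply: le_trans bNt; rewrite w2.
    apply: ler_pM; rewrite ?sqr_ge0 ?mulr_ge0 ?sqnorm_ge0//.
      by rewrite ler_pM2l.
    by rewrite lerXn2r ?nnegrE// (le_trans jt0).
  rewrite [l j ^+ k](_ : _ = expR (k%:R * w)); last by rewrite expRM_natl.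
  rewrite -expRD ler_expR; lra.
have sA : (\sum_(j < N) std_normal k (A j) <= 1)%E.
  rewrite -measure_bigsetU//; apply: probability_le1.
  exact: bigsetU_measurable.
have : (\sum_(j < N) ((expR (- 1)%R)%:E *
    std_normal k [set z | (a < sqnorm z <= b)%R]) <= 1)%E.
  by apply: le_trans sA; apply: lee_sum => j _; exact: PA.
set p := std_normal k _.
have pf : p \is a fin_num by rewrite fin_num_measure//; exact: measurable_sqnorm_itv.
rewrite -(fineK pf) -EFinM sumEFin sumr_const card_ord lee_fin => h.
rewrite -EFinM lee_fin -[leRHS]mul1r -ler_pdivrMr ?expR_gt0// -expRN.
by rewrite -mulrA (mulrC (fine p)) mulr_natl.
Qed.

(** Windows starting below [h] lie in a small ball. Above [h], a window of width [D] has relative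
    width at most D / h = 1 / (4 N), which leaves room for [N] dilates; no constant depends on
    [k]. *)
Lemma chi_anticoncentration (e : R) : 0 < e -> exists2 D : R, 0 < D &
  forall k, (0 < k)%N -> forall x : R,
  (std_normal k [set z | (x < enorm z <= x + D)%R] <= e%:E)%E.
Proof.
(* So many dilates bring the mass exp 1 / N of a shell below e / 2, as two shells will be needed. *)
move=> e0; pose N := (Num.trunc (2 * expR 1 / e)).+1.
have N0 : 0 < N%:R :> R by rewrite ltr0n.
have NE : 2 * expR 1 / e < N%:R by exact: truncnS_gt.
pose q := expR (1 / 2) : R.
have q1 : 1 <= q by rewrite /q -[leLHS]expR0 ler_expR; lra.
(* Chosen so that the ball of radius [2 * h], which is at most 1, has mass at most [e]. *)
pose h := Num.min (1 / 2) (e / (2 * q)).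
have h0 : 0 < h by rewrite lt_min !divr_gt0// mulr_gt0// (lt_le_trans ltr01).
have h2 : h <= 1 / 2 by rewrite ge_min lexx.
have hq : 2 * h * q <= e.
  have : h <= e / (2 * q) by rewrite ge_min lexx orbT.
  by rewrite ler_pdivlMr ?mulr_gt0 ?(lt_le_trans ltr01)//; lra.
pose D := h / (4 * N%:R).
have D0 : 0 < D by rewrite divr_gt0// mulr_gt0.
have ND : N%:R * D = h / 4 by rewrite /D; field; rewrite gt_eqF.
have Dh : D <= h / 4.
  by rewrite -ND ler_peMl ?ler1n // ltW.
exists D => // k k0 x.
have menorm (a b : R) : measurable [set z : 'cV[R]_k | a < enorm z <= b].
  rewrite [X in measurable X](_ : _ = @enorm R k @^-1` `]a, b]); last first.
    by apply/seteqP; split => z; rewrite /= in_itv.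
  by rewrite -[X in measurable X]setTI; apply: measurable_enorm.
have [xh|hx] := ltP x h.
  apply: (@le_trans _ _ (2 * h * q)%:E); last by rewrite lee_fin.
  have h20 : 0 < 2 * h by lra.
  have h21 : 2 * h <= 1 by lra.
  apply: le_trans (chi_square_small_ball k0 h20 h21).
  apply: le_measure; rewrite ?inE; [exact: menorm|exact: measurable_sqnorm_le|].
  move=> z /= /andP[_ zx]; rewrite -enorm_sqr lerXn2r ?nnegrE ?enorm_ge0//; lra.
have x0 : 0 < x by lra.
pose t := D / x; have t0 : 0 <= t by rewrite divr_ge0// ltW.
have tx : t * x = D by rewrite /t divfK// gt_eqF.
have Nt : N%:R * t <= 1 / 4.
  by rewrite /t mulrA ND ler_pdivrMr//; lra.
have t4 : t <= 1 / 4 by rewrite /t ler_pdivrMr//; lra.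
pose a := x ^+ 2; pose b := (x + D) ^+ 2.
have a0 : 0 <= a by exact: sqr_ge0.
have ab : b <= expR t ^+ 2 * a.
  rewrite -exprMn lerXn2r ?nnegrE ?mulr_ge0 ?expR_ge0 ?addr_ge0 ?(ltW x0) ?(ltW D0)//.
  have : (1 + t) * x <= expR t * x by rewrite ler_wpM2r ?(ltW x0)// expR_ge1Dx.
  by rewrite mulrDl mul1r tx.
have bNt : 4 * b * (N%:R * t) ^+ 2 <= 1.
  have -> : 4 * b * (N%:R * t) ^+ 2 = 4 * ((1 + t) * (N%:R * D)) ^+ 2.
    by rewrite /b -tx; ring.
  rewrite ND.
  have : (1 + t) * (h / 4) <= 1 / 2 by nra.
  have : 0 <= (1 + t) * (h / 4) by rewrite mulr_ge0; lra.
  set u := _ * _; nra.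
(* The shell is cut at squared radius [k], because the direction of the dilations changes there. *)
pose A1 := [set z : 'cV[R]_k | a < sqnorm z <= Num.min b k%:R].
pose A2 := [set z : 'cV[R]_k | Num.max a k%:R < sqnorm z <= b].
have mA1 : measurable A1 by exact: measurable_sqnorm_itv.
have mA2 : measurable A2 by exact: measurable_sqnorm_itv.
have shell A : measurable A -> (N%:R%:E * std_normal k A <= (expR 1)%:E)%E ->
    (std_normal k A <= (e / 2)%:E)%E.
  move=> mA; have pf : std_normal k A \is a fin_num by rewrite fin_num_measure.
  rewrite -(fineK pf) -EFinM !lee_fin => hA.
  rewrite -(ler_pM2l N0) (le_trans hA)//.
  by move: NE; rewrite ltr_pdivrMr//; lra.
have P1 : (std_normal k A1 <= (e / 2)%:E)%E.
  apply: shell => //; apply: (@chi_square_shell k N t) => //.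
  - by rewrite (le_trans _ ab)// ge_min lexx.
  - apply: le_trans bNt; rewrite ler_wpM2r ?sqr_ge0// ler_wpM2l//.
    by rewrite ge_min lexx.
  - by rewrite ge_min lexx orbT.
have P2 : (std_normal k A2 <= (e / 2)%:E)%E.
  apply: shell => //; apply: (@chi_square_shell k N t) => //.
  - by rewrite le_max a0.
  - by rewrite (le_trans ab)// ler_wpM2l ?sqr_ge0// le_max lexx.
  - by rewrite le_max lexx !orbT.
apply: (@le_trans _ _ (std_normal k (A1 `|` A2))).
  apply: le_measure; rewrite ?inE; [exact: menorm|exact: measurableU|].
  move=> z /= /andP[zx zD].
  have za : a < sqnorm z by rewrite -enorm_sqr ltrXn2r ?nnegrE ?enorm_ge0// ltW.
  have zb : sqnorm z <= b.
    by rewrite -enorm_sqr lerXn2r ?nnegrE ?enorm_ge0// addr_ge0 ?ltW.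
  have [zk|kz] := leP (sqnorm z) k%:R; [left|right]; rewrite /A1 /A2 /=.
    by rewrite za le_min zb zk.
  by rewrite gt_max za kz zb.
apply: (le_trans (measureU2 _ mA1 mA2)).
by rewrite [e]splitr EFinD leeD.
Qed.

End chi_square.

(** * Orthogonal projections and the law of projected Gaussian vectors *)

Section projections.
Context {R : realType}.

(** A nonzero column of [P], normalised, is a unit vector fixed by [P]. Once it is rotated onto the
    first axis, symmetry splits the projection as 1 plus a smaller one, and induction applies. *)
Lemma sym_proj_factor n (P : 'M[R]_n) : P^T = P -> P *m P = P ->
  exists k (Q : 'M[R]_(n, k)), Q *m Q^T = P /\ Q^T *m Q = 1%:M.
Proof.
elim: n P => [|n IH] P Ps PP.
  exists 0%N, 0; split; first by rewrite mul0mx [RHS]flatmx0.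
  by rewrite mulmx0 [RHS]flatmx0.
have [->|P0] := eqVneq P 0.
  exists 0%N, 0; split; first by rewrite mul0mx.
  by rewrite [LHS]flatmx0 [RHS]flatmx0.
have [j Pj] : exists j, col j P != 0.
  apply/existsP; apply: contraNT P0; rewrite negb_exists => /forallP h.
  apply/eqP/matrixP => i j; have := h j.
  by rewrite negbK => /eqP/colP/(_ i); rewrite !mxE.
pose r := enorm (col j P); have r2 : r ^+ 2 = sqnorm (col j P) by exact: enorm_sqr.
have r0 : r != 0.
  by apply: contra_neq Pj => r0; apply: sqnorm_eq0; rewrite -r2 r0 expr0n.
pose v := r^-1 *: col j P.
have v1 : sqnorm v = 1 by rewrite sqnormZ -r2 exprVn mulVf// expf_neq0.
have Pv : P *m v = v by rewrite /v -scalemxAr colE mulmxA PP.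
have [U [_ UU Uv]] := gaussian_invariant_e0 v1.
have UU' : U *m U^T = 1%:M by exact: mulmx1C.
pose P1 := U *m P *m U^T.
have P1s : P1^T = P1 by rewrite /P1 !trmx_mul trmxK Ps mulmxA.
have P1P1 : P1 *m P1 = P1.
  by rewrite /P1 -!mulmxA (mulmxA U^T) UU mul1mx (mulmxA P) PP.
have P1e : P1 *m cons_cV (1, 0 : 'cV[R]_n) = cons_cV (1, 0).
  by rewrite -Uv /P1 -!mulmxA (mulmxA U^T) UU mul1mx Pv.
have P1U : U^T *m (P1 *m U) = P.
  by rewrite /P1 -!mulmxA UU mulmx1 mulmxA UU mul1mx.
clearbody P1.
have [P' P'E] : exists P' : 'M[R]_n, P1 = lift_mx P'.
  have := P1e; rewrite -[P1 in LHS](@submxK R 1 n 1 n).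
  move/(etrans (esym (@mul_block_col R 1 n 1 n 1 _ _ _ _ _ _))).
  rewrite !mulmx0 !addr0 => /(@eq_col_mx R 1 n 1)[A1 C0].
  have one : const_mx 1 = 1%:M :> 'M[R]_1.
    by apply/matrixP => i k; rewrite !mxE !ord1.
  rewrite /= one mulmx1 in A1; rewrite /= one mulmx1 in C0.
  exists (@drsubmx R 1 n 1 n P1); apply: (etrans (esym (@submxK R 1 n 1 n P1))).
  rewrite A1 C0 /lift_mx; congr (@block_mx R 1 n 1 n _ _ _ _).
  by rewrite -P1s -(@trmx_dlsub R 1 n 1 n) C0 trmx0.
have := P1s; rewrite P'E tr_lift_mx => /(congr1 (@drsubmx R 1 n 1 n)).
rewrite !(@block_mxKdr R 1 n 1 n) => P's.
have := P1P1; rewrite P'E lift_mxM => /(congr1 (@drsubmx R 1 n 1 n)).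
rewrite !(@block_mxKdr R 1 n 1 n) => P'P'.
have [k [Q [QQ QQ']]] := IH P' P's P'P'.
exists k.+1, (U^T *m lift_mx Q); split; rewrite trmx_mul trmxK tr_lift_mx.
  rewrite -mulmxA (mulmxA (lift_mx Q)) lift_mxM QQ -P'E.
  exact: P1U.
by rewrite -mulmxA (mulmxA U) UU' mul1mx lift_mxM QQ' lift_mx1.
Qed.

Lemma std_normal_orth_set k m (O : 'M[R]_(k, m)) (A : set 'cV[R]_k) :
  O *m O^T = 1%:M -> measurable A ->
  std_normal m [set z | A (O *m z)] = std_normal k A.
Proof.
move=> OO mA.
have mOA : measurable [set z : 'cV[R]_m | A (O *m z)].
  by have := measurable_mulmx O measurableT mA; rewrite setTI.
rewrite -[X in std_normal m X]setIT -integral_indic//.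
rewrite -[X in std_normal k X]setIT -integral_indic//.
rewrite -(std_normal_orth (F := fun z => (\1_A z)%:E) OO)//.
exact/measurable_EFinP.
Qed.

(** If P = Q Q^T with Q^T Q = 1 and V has the law of A Z with A A^T = s^2 I, then O = s^(-1) Q^T A
    has orthonormal rows, whatever the factor [A], and |P A z| / s = |O z|. *)
Lemma gaussian_sqnorm_law d (T : measurableType d) (Pr : probability T R) n
    (V : {RV Pr >-> 'cV[R]_n}) (s : R) (P : 'M[R]_n) (E : set R) :
  0 < s -> is_gaussian V ((s ^+ 2)%:M) -> P^T = P -> P *m P = P ->
  measurable E ->
  Pr [set w | E (sqnorm (P *m V w) / s ^+ 2)] =
  std_normal (\rank P) [set z | E (sqnorm z)].
Proof.
move=> s0 [m [A [AA VA]]] Ps PP mE.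
have [k [Q [QQ QQ']]] := sym_proj_factor Ps PP.
have -> : \rank P = k.
  apply/eqP; rewrite eqn_leq; apply/andP; split.
    by rewrite -QQ (leq_trans (mxrankM_maxl _ _))// rank_leq_col.
  rewrite -{1}(mxrank1 R k) -[1%:M]mulmx1 -QQ' mulmxA -(mulmxA Q^T) QQ.
  by rewrite (leq_trans (mxrankM_maxl _ _))// mxrankM_maxr.
pose B := [set v : 'cV[R]_n | E (sqnorm (P *m v) / s ^+ 2)].
have mS l : measurable [set z : 'cV[R]_l | E (sqnorm z)].
  by have := @measurable_sqnorm R l measurableT _ mE; rewrite setTI.
have mB : measurable B.
  have mf : measurable_fun [set: 'cV[R]_n] (fun v => sqnorm (P *m v) / s ^+ 2).
    apply: measurable_funM => //.
    exact: (measurableT_comp (@measurable_sqnorm R n) (measurable_mulmx P)).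
  by have := mf measurableT _ mE; rewrite setTI.
transitivity (distribution Pr V B); first by [].
rewrite VA//; pose O := s^-1 *: (Q^T *m A).
have OO : O *m O^T = 1%:M.
  rewrite /O linearZ/= -scalemxAl -scalemxAr scalerA trmx_mul trmxK.
  rewrite mulmxA -(mulmxA _ A) AA mul_mx_scalar -scalemxAl QQ' scalerA.
  by rewrite -expr2 -exprMn mulVf ?gt_eqF// expr1n scale1r.
rewrite -(std_normal_orth_set OO)//; congr (std_normal m _).
apply/seteqP; suff h z : sqnorm (P *m (A *m z)) / s ^+ 2 = sqnorm (O *m z).
  by split => z; rewrite /B /= h.
rewrite /O -scalemxAl sqnormZ exprVn mulrC; congr (_ * _).
rewrite !sqnorm_tr; congr (fun_of_matrix _ 0 0).
by rewrite trmx_mul Ps -mulmxA (mulmxA P) PP -QQ -!mulmxA !trmx_mul trmxK !mulmxA.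
Qed.

End projections.

(** * Euclidean and spectral norms *)

Section euclidean_norm.
Context {R : realType}.

Lemma cauchy_schwarz_sum (I : finType) (u v : I -> R) :
  (\sum_i u i * v i) ^+ 2 <= (\sum_i u i ^+ 2) * (\sum_i v i ^+ 2).
Proof.
set a := \sum_i _ * _; set b := \sum_i u i ^+ 2; set c := \sum_i v i ^+ 2.
have b0 : 0 <= b by apply: sumr_ge0 => i _; exact: sqr_ge0.
have c0 : 0 <= c by apply: sumr_ge0 => i _; exact: sqr_ge0.
have h x y : 0 <= x ^+ 2 * b - 2 * x * y * a + y ^+ 2 * c.
  have -> : x ^+ 2 * b - 2 * x * y * a + y ^+ 2 * c =
      \sum_i (x * u i - y * v i) ^+ 2.
    rewrite /a /b /c !mulr_sumr -sumrB -big_split/=; apply: eq_bigr => i _.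
    ring.
  by apply: sumr_ge0 => i _; exact: sqr_ge0.
(* If c = 0 the form is linear in y, and x = a, y = b + 1 force a = 0; otherwise x = c and y = a are
   the usual minimiser up to scaling. *)
have [c00|cn0] := eqVneq c 0.
  have := h a (b + 1); rewrite c00 mulr0; have := sqr_ge0 a; nra.
have := h c a.
have -> : c ^+ 2 * b - 2 * c * a * a + a ^+ 2 * c = c * (b * c - a ^+ 2) by ring.
by rewrite pmulr_rge0 ?lt_def ?cn0// subr_ge0.
Qed.

Lemma sqnorm_mulmx_le m n (A : 'M[R]_(m, n)) (x : 'cV[R]_n) :
  sqnorm (A *m x) <= (\sum_(i < m) \sum_(j < n) A i j ^+ 2) * sqnorm x.
Proof.
rewrite /sqnorm mulr_suml; apply: ler_sum => i _.
by rewrite mxE; exact: cauchy_schwarz_sum.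
Qed.

Lemma enormZ n (a : R) (x : 'cV[R]_n) : enorm (a *: x) = `|a| * enorm x.
Proof.
by rewrite {1}/enorm -/(sqnorm _) sqnormZ sqrtrM ?sqr_ge0// sqrtr_sqr.
Qed.

Lemma enorm0 n : enorm (0 : 'cV[R]_n) = 0.
Proof. by rewrite -(scale0r 0) enormZ normr0 mul0r. Qed.

Lemma enormN n (x : 'cV[R]_n) : enorm (- x) = enorm x.
Proof. by rewrite -scaleN1r enormZ normrN1 mul1r. Qed.

Lemma enorm_eq0 n (x : 'cV[R]_n) : enorm x = 0 -> x = 0.
Proof. by move=> x0; apply: sqnorm_eq0; rewrite -enorm_sqr x0 expr0n. Qed.

Lemma ler_enormD n (x y : 'cV[R]_n) : enorm (x + y) <= enorm x + enorm y.
Proof.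
rewrite -(@ler_pXn2r _ 2)// ?nnegrE ?addr_ge0 ?enorm_ge0//.
have xy : \sum_i x i 0 * y i 0 <= enorm x * enorm y.
  apply: (le_trans (ler_norm _)); rewrite -(@ler_pXn2r _ 2)// ?nnegrE ?mulr_ge0 ?enorm_ge0//.
  by rewrite real_normK ?num_real// exprMn !enorm_sqr cauchy_schwarz_sum.
rewrite sqrrD !enorm_sqr.
have -> : sqnorm (x + y) = sqnorm x + (\sum_i x i 0 * y i 0) *+ 2 + sqnorm y.
  rewrite /sqnorm -sumrMnl -!big_split/=; apply: eq_bigr => i _.
  by rewrite mxE sqrrD.
by rewrite lerD2r lerD2l lerMn2r xy.
Qed.

Lemma ler_enorm_sum n (I : Type) (r : seq I) (P : pred I) (f : I -> 'cV[R]_n) :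
  enorm (\sum_(i <- r | P i) f i) <= \sum_(i <- r | P i) enorm (f i).
Proof.
elim/big_ind2: _ => // [|x a y b xa yb]; first by rewrite enorm0.
by rewrite (le_trans (ler_enormD _ _))// lerD.
Qed.

Lemma spectral_norm_bound m n (A : 'M[R]_(m, n)) (x : 'cV[R]_n) :
  enorm (A *m x) <= spectral_norm A * enorm x.
Proof.
pose S := [set enorm (A *m x) | x in [set x : 'cV[R]_n | enorm x <= 1]].
(* The supremum is meaningful only for a bounded set; the Frobenius norm is a bound. *)
have ubS : has_ubound S.
  exists (Num.sqrt (\sum_(i < m) \sum_(j < n) A i j ^+ 2)) => _ [z /= z1 <-].
  rewrite ler_wsqrtr// -/(sqnorm _) (le_trans (sqnorm_mulmx_le _ _))//.
  rewrite ler_piMr//.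
    by apply: sumr_ge0 => i _; apply: sumr_ge0 => j _; exact: sqr_ge0.
  by rewrite -enorm_sqr expr_le1// enorm_ge0.
have [x0|x0] := eqVneq (enorm x) 0.
  by rewrite (enorm_eq0 x0) mulmx0 !enorm0 mulr0.
have xp : 0 < enorm x by rewrite lt_def x0 enorm_ge0.
rewrite -ler_pdivrMr// mulrC -[X in X * _]gtr0_norm ?invr_gt0// -enormZ scalemxAr.
apply: ub_le_sup => //; exists ((enorm x)^-1 *: x) => //=.
by rewrite enormZ gtr0_norm ?invr_gt0// mulVf.
Qed.

End euclidean_norm.

(** * Pseudo-inverses under a projection *)

Section projection_algebra.
Context {R : realType}.

Lemma orthproj_mulmx m n (A : 'M[R]_(m, n)) : orthproj A *m A = A.
Proof.
have [Qs QQ /andP[_ /submxP[D AD]]] := orthprojP A.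
have {}AD : A = orthproj A *m D^T by rewrite -[LHS]trmxK AD trmx_mul trmxK.
by rewrite {2}AD mulmxA QQ -AD.
Qed.

Lemma orthproj_mulmx0 m n (A : 'M[R]_(m, n)) (w : 'cV[R]_m) :
  A^T *m w = 0 -> orthproj A *m w = 0.
Proof.
have [Qs QQ /andP[/submxP[D AD] _]] := orthprojP A.
by move=> Aw; rewrite -Qs AD -mulmxA Aw mulmx0.
Qed.

(** The columns of P A span the range of P: a vector w of that range orthogonal to them satisfies
    A^T w = 0, so w = P (1 - Q_A) w, and a spectral norm below 1 leaves only w = 0. *)
Lemma pinv_mulmx_proj m n (P : 'M[R]_m) (A : 'M[R]_(m, n)) :
  P *m P = P -> P^T = P -> spectral_norm (P *m (1%:M - orthproj A)) < 1 ->
  P *m A *m Defs.pinv (P *m A) *m P = P.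
Proof.
move=> PP Ps P1; have [HB _ Hs _] := Defs.pinvP (P *m A).
set B := P *m A in HB Hs *; set H := B *m Defs.pinv B in HB Hs *.
have PH : P *m H = H by rewrite /H /B !mulmxA PP.
clearbody H.
apply: mulmx_cV_inj => v; pose w := P *m v - H *m P *m v.
suff w0 : w = 0 by apply/esym/eqP; rewrite -subr_eq0 -/w w0.
have Pw : P *m w = w by rewrite /w mulmxBr !mulmxA PP PH.
have BH : B^T *m H = B^T by rewrite -{1}Hs -trmx_mul HB.
have Aw : A^T *m w = 0.
  rewrite -Pw -{1}Ps mulmxA -trmx_mul -/B /w mulmxBr !mulmxA BH subrr//.
have := spectral_norm_bound (P *m (1%:M - orthproj A)) w.
rewrite -mulmxA mulmxBl mul1mx (orthproj_mulmx0 Aw) subr0 Pw => h.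
apply: enorm_eq0; apply/eqP; rewrite eq_le enorm_ge0 andbT leNgt; apply/negP => wp.
by move: h; rewrite leNgt gtr_pMl// P1.
Qed.

(** The identity above factors [P] through [A], which has n columns. *)
Lemma rank_proj_le m n (P : 'M[R]_m) (A : 'M[R]_(m, n)) :
  P *m P = P -> P^T = P -> spectral_norm (P *m (1%:M - orthproj A)) < 1 ->
  (\rank P <= n)%N.
Proof.
move=> PP Ps P1; rewrite -(pinv_mulmx_proj PP Ps P1).
rewrite (leq_trans (mxrankM_maxl _ _))// (leq_trans (mxrankM_maxl _ _))//.
exact: rank_leq_col.
Qed.

End projection_algebra.

(** * Splitting a linear predictor along the groups *)

Section group_algebra.
Context {R : realType} {n p M : nat}.
Implicit Types (X : 'M[R]_(n, p)) (Gr : 'I_M -> {set 'I_p}) (G A : {set 'I_p}).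

Lemma subm_subvE A X (u : 'cV[R]_p) :
  subm A X *m subv A u = \sum_(i in A) u i 0 *: col i X.
Proof.
apply/colP => i; rewrite !mxE summxE.
rewrite [RHS]big_enum_val/=.
by apply: eq_bigr => j _; rewrite !mxE mulrC.
Qed.

Lemma mulmx_col_sum X (u : 'cV[R]_p) : X *m u = \sum_i u i 0 *: col i X.
Proof.
by apply/colP => i; rewrite !mxE summxE; apply: eq_bigr => j _; rewrite !mxE mulrC.
Qed.

Lemma subvB A (u v : 'cV[R]_p) : subv A (u - v) = subv A u - subv A v.
Proof. by apply/colP => i; rewrite !mxE. Qed.

Lemma subvD A (u v : 'cV[R]_p) : subv A (u + v) = subv A u + subv A v.
Proof. by apply/colP => i; rewrite !mxE. Qed.

Lemma subvZ A a (u : 'cV[R]_p) : subv A (a *: u) = a *: subv A u.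
Proof. by apply/colP => i; rewrite !mxE. Qed.

Lemma mulmx_group_split X Gr G (u : 'cV[R]_p) : group_partition Gr ->
  X *m u = subm G X *m subv G u +
    \sum_(k < M | ~~ (Gr k \subset G)) subm (Gr k :\: G) X *m subv (Gr k :\: G) u.
Proof.
move=> [injG partG]; rewrite mulmx_col_sum subm_subvE (bigID (mem G))/=.
congr (_ + _); pose f i := if i \in G then 0 else u i 0 *: col i X.
transitivity (\sum_(i in [set: 'I_p]%SET) f i).
  rewrite big_mkcond [RHS]big_mkcond; apply: eq_bigr => i _.
  by rewrite finset.in_setT /f; case: (i \in G).
rewrite (finset.set_partition_big _ partG)/= big_imset/=; last first.
  by move=> i j _ _; exact: injG.
rewrite [RHS]big_mkcond/=; apply: eq_bigr => k _; case: ifPn => [|/negbNE] GkG.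
  rewrite subm_subvE big_mkcond [RHS]big_mkcond; apply: eq_bigr => i _.
  by rewrite inE /f; case: (i \in Gr k); case: (i \in G).
by apply: big1 => i iGk; rewrite /f (fintype.subsetP GkG).
Qed.

End group_algebra.

(** * Error of the debiased estimator and its bias *)

Section debiased_estimator.
Context {R : realType} {n p M : nat}.
Variables (X : 'M[R]_(n, p)) (Gr : 'I_M -> {set 'I_p}) (G : {set 'I_p}).
Variables (PG : 'M[R]_n) (beta b : 'cV[R]_p) (eps : 'cV[R]_n).
Hypotheses (partG : group_partition Gr) (PP : PG *m PG = PG) (PT : PG^T = PG).
Let y := X *m beta + eps.

Definition bias : 'cV[R]_n := \sum_(k < M | ~~ (Gr k \subset G))
  subm (Gr k :\: G) X *m subv (Gr k :\: G) (beta - b).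

(** The residual is the initial error carried by X_G plus [eps + bias]. After projection the
    correction reproduces it in full, so the initial error on [G] cancels exactly. *)
Lemma debiased_errorE : spectral_norm (PG *m (1%:M - orthproj (subm G X))) < 1 ->
  PG *m subm G X *m (debiased X G PG b y - subv G beta) = PG *m (eps + bias).
Proof.
move=> P1; rewrite /debiased addrAC mulmxDr !mulmxA (pinv_mulmx_proj PP PT P1).
have -> : y - X *m b = subm G X *m (subv G beta - subv G b) + (eps + bias).
  rewrite /y addrAC -mulmxBr (mulmx_group_split X G (beta - b) partG) -subvB.
  by rewrite -addrA; congr (_ + _); rewrite addrC.
by rewrite mulmxDr mulmxA addrA -mulmxDr addrA subrK subrr mulmx0 add0r.
Qed.

Lemma prediction_errorE (c : 'cV[R]_#|G|) :
  PG *m orthproj (subm G X) *m (subm G X *m c - subm G X *m subv G beta) =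
  PG *m subm G X *m (c - subv G beta).
Proof. by rewrite -mulmxBr !mulmxA -(mulmxA PG) orthproj_mulmx. Qed.

Lemma test_statE (sh : R) : subm G X *m subv G beta = 0 ->
  test_stat X Gr G PG b sh y = sh^-1 * enorm (PG *m (eps + bias)).
Proof.
move=> mu0; rewrite /test_stat; congr (_ * enorm (PG *m _)).
rewrite /y (mulmx_group_split X G beta partG) mu0 add0r addrAC -sumrB addrC.
by congr (_ + _); apply: eq_bigr => k _; rewrite -mulmxBr -subvB.
Qed.

Variables (omega' : 'I_M -> R) (sigma : R).
Hypotheses (sigma0 : 0 < sigma)
  (omega'0 : forall k, ~~ (Gr k \subset G) -> 0 <= omega' k)
  (PQ : forall k, ~~ (Gr k \subset G) ->
    spectral_norm (PG *m orthproj (subm (Gr k :\: G) X)) <= omega' k)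
  (n0 : (0 < n)%N).

Lemma Mfac_ge0 k : (0 <= Mfac X Gr G k)%E.
Proof. by apply: ereal_sup_ubound; left. Qed.

(** Homogeneity settles the case X_{G_k} u <> 0. The degenerate directions need finiteness of the
    supremum, or the vanishing of X_{G_k}. *)
Lemma Mfac_bound k (m : R) (u : 'cV[R]_p) : Mfac X Gr G k = m%:E ->
  enorm (subm (Gr k :\: G) X *m subv (Gr k :\: G) u) <=
  m * enorm (subm (Gr k) X *m subv (Gr k) u).
Proof.
move=> mE; pose f u := subm (Gr k :\: G) X *m subv (Gr k :\: G) u.
pose h u := subm (Gr k) X *m subv (Gr k) u.
have hZ a v : h (a *: v) = a *: h v by rewrite /h subvZ scalemxAr.
have fZ a v : f (a *: v) = a *: f v by rewrite /f subvZ scalemxAr.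
have hD v w : h (v + w) = h v + h w by rewrite /h subvD mulmxDr.
have fD v w : f (v + w) = f v + f w by rewrite /f subvD mulmxDr.
have m0 : 0 <= m by rewrite -lee_fin -mE Mfac_ge0.
have h1 v : enorm (h v) = 1 -> enorm (f v) <= m.
  move=> hv; rewrite -lee_fin -mE; apply: ereal_sup_ubound; right.
  by exists v.
rewrite -/(f u) -/(h u); have [hu0|hu] := eqVneq (enorm (h u)) 0; last first.
  have hup : 0 < enorm (h u) by rewrite lt_def hu enorm_ge0.
  have := h1 ((enorm (h u))^-1 *: u).
  rewrite hZ fZ !enormZ gtr0_norm ?invr_gt0// mulVf// => /(_ erefl).
  by rewrite mulrC ler_pdivrMr.
rewrite hu0 mulr0; have h0 := enorm_eq0 hu0.
(* If some [w] is normalised, then so is [w + t *: u] for every t, since [h u = 0]; a finite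
   supremum thus forces [f u = 0]. *)
have [[v hv]|nv] := pselect (exists v, enorm (h v) != 0).
  have hvp : 0 < enorm (h v) by rewrite lt_def hv enorm_ge0.
  pose w := (enorm (h v))^-1 *: v.
  have hw : enorm (h w) = 1 by rewrite hZ enormZ gtr0_norm ?invr_gt0// mulVf.
  have bnd t : 0 <= t -> t * enorm (f u) <= m + m.
    move=> t0; rewrite -{1}(ger0_norm t0) -enormZ -fZ.
    have -> : f (t *: u) = f (w + t *: u) - f w by rewrite fD addrAC subrr add0r.
    rewrite (le_trans (ler_enormD _ _))// enormN lerD// ?h1//.
    by rewrite hD (hZ t u) h0 scaler0 addr0.
  rewrite leNgt; apply/negP => fu.
  have mm0 : 0 <= m + m + 1 by lra.
  by have := bnd _ (divr_ge0 mm0 (ltW fu)); rewrite divfK ?gt_eqF//; lra.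
have {}nv v : h v = 0.
  apply: enorm_eq0; apply: contrapT => hv; apply: nv; exists v; exact/eqP.
(* Here X_{G_k} vanishes identically and the supremum carries no information; cutting [u] off on [G]
   exhibits [f u] as a value of [h]. *)
pose u' : 'cV[R]_p := \col_i (if i \in G then 0 else u i 0).
suff -> : f u = h u' by rewrite nv enorm0.
rewrite /f /h !subm_subvE big_mkcond [RHS]big_mkcond; apply: eq_bigr => i _.
rewrite finset.in_setD mxE; case: (i \in Gr k); case: (i \in G) => //=.
by rewrite scale0r.
Qed.

Lemma omega_star_gt0 k : 0 < omega_star (n := n) (R := R) Gr k.
Proof.
rewrite /omega_star ltr_pwDl// ?sqrtr_ge0// sqrtr_gt0 divr_gt0 ?ltr0n//.
have [_ /and3P[_ _ G0]] := partG.
rewrite lt0n cards_eq0; apply: contra G0 => /eqP <-.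
by apply/finset.imsetP; exists k.
Qed.

Lemma max_ratio_ge0 : (0 <= max_ratio X Gr G omega')%E.
Proof.
rewrite /max_ratio; elim/big_ind: _ => // [x z x0 z0|k kG].
  by rewrite le_max x0.
by rewrite mule_ge0 ?Mfac_ge0// lee_fin divr_ge0 ?omega'0// ltW// omega_star_gt0.
Qed.

(** Group by group: insert Q_{G_k \ G} to gain omega'_k, use M_k to pass to the whole group, and
    trade M_k omega'_k for the maximal ratio times omega_{*,k}. *)
Lemma bias_bound : (max_ratio X Gr G omega' < +oo)%E ->
  enorm (PG *m bias) <= sigma * (fine (max_ratio X Gr G omega') *
    group_error X Gr b beta sigma).
Proof.
move=> mroo.
have mr0 := max_ratio_ge0.
have mrf : max_ratio X Gr G omega' \is a fin_num by rewrite ge0_fin_numE.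
set mr := fine _; have mrE : max_ratio X Gr G omega' = mr%:E by rewrite fineK.
have {}mr0 : 0 <= mr by rewrite fine_ge0.
have mrk k : ~~ (Gr k \subset G) ->
    (Mfac X Gr G k * (omega' k / omega_star (n := n) Gr k)%:E <= mr%:E)%E.
  by move=> kG; rewrite -mrE /max_ratio (bigD1 k)//= le_max lexx.
have term k : ~~ (Gr k \subset G) ->
    enorm (PG *m (subm (Gr k :\: G) X *m subv (Gr k :\: G) (beta - b))) <=
    mr * (omega_star (n := n) Gr k *
      enorm (subm (Gr k) X *m subv (Gr k) b - subm (Gr k) X *m subv (Gr k) beta)).
  move=> kG; set u := beta - b; have ws0 := omega_star_gt0 k.
  have -> : enorm (subm (Gr k) X *m subv (Gr k) b - subm (Gr k) X *m subv (Gr k) beta)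
      = enorm (subm (Gr k) X *m subv (Gr k) u).
    rewrite -mulmxBr -subvB -enormN -mulmxN; congr (enorm (_ *m _)).
    by apply/colP => i; rewrite !mxE opprB.
  have h1 : enorm (PG *m (subm (Gr k :\: G) X *m subv (Gr k :\: G) u)) <=
      omega' k * enorm (subm (Gr k :\: G) X *m subv (Gr k :\: G) u).
    set S := subm _ X; set v := subv _ u.
    have SvE : S *m v = orthproj S *m (S *m v) by rewrite mulmxA orthproj_mulmx.
    rewrite {1}SvE mulmxA (le_trans (spectral_norm_bound _ _))//.
    by rewrite ler_wpM2r ?enorm_ge0 ?PQ.
  (* If omega'_k = 0, then M_k may be infinite without affecting the product, but the term is 0. If
     omega'_k > 0, a finite maximal ratio makes M_k finite. *)
  apply: (le_trans h1); have := omega'0 kG; rewrite le0r => /orP[/eqP ->|w0].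
    by rewrite mul0r !mulr_ge0 ?enorm_ge0// ltW.
  have r0 : 0 < omega' k / omega_star (n := n) Gr k by rewrite divr_gt0.
  have := mrk k kG; have := Mfac_ge0 k; have := @Mfac_bound k.
  case: (Mfac X Gr G k) => [m|_|//]; last first.
    by rewrite mulyr gtr0_sg// mul1e leye_eq.
  move=> /(_ m u erefl) hm; rewrite lee_fin => m0.
  rewrite -EFinM lee_fin => hmr; rewrite mulrA ler_pdivrMr// in hmr.
  apply: (@le_trans _ _ (omega' k * (m * enorm (subm (Gr k) X *m subv (Gr k) u)))).
    by rewrite ler_pM2l.
  by rewrite !mulrA ler_wpM2r ?enorm_ge0// mulrC.
rewrite /bias mulmx_sumr (le_trans (ler_enorm_sum _ _ _))//.
rewrite mulrCA /group_error [sigma * _]mulr_sumr mulr_sumr.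
rewrite [leRHS](bigID (fun k => ~~ (Gr k \subset G)))/=.
rewrite -[leLHS]addr0 lerD//.
  apply: ler_sum => k kG; apply: (le_trans (term k kG)).
  set E := enorm _; set o := omega_star _ _.
  by rewrite [X in _ <= mr * X](_ : _ = o * E)//; field; rewrite gt_eqF.
apply: sumr_ge0 => k _; rewrite !mulr_ge0 ?enorm_ge0 ?invr_ge0 ?(ltW sigma0)//.
by rewrite ltW// omega_star_gt0.
Qed.

End debiased_estimator.

(** The ratio q = sh / s is the product of sh / (|eps| / r), within A of 1, and S = |eps| / (r s),
    within C / r of 1. Hence |q - 1| <= k <= 1/2, which yields 1/q <= 2 and |1/q - 1| <= 2 k. *)
Lemma studentized_error_bound (R : realType) n (eps e1 e2 : 'cV[R]_n)
    (sh s r A C w m : R) : 0 < s -> 0 < r ->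
  `|sh / (enorm eps / r) - 1| <= A ->
  `|sqnorm eps / s ^+ 2 - r ^+ 2| <= C * r ->
  2 * A + C / r <= 1 / 2 ->
  enorm e1 / s <= w -> enorm e2 / s <= m ->
  sh != 0 /\
  enorm (sh^-1 *: (e1 + e2) - s^-1 *: e1) <= 2 * (2 * A + C / r) * w + 2 * m.
Proof.
move=> s0 r0 hA hC k2 hw hm; set k := 2 * A + C / r in k2 *.
pose S := enorm eps / r / s.
have S0 : 0 <= S by rewrite !divr_ge0 ?enorm_ge0 ?ltW.
have A0 : 0 <= A by exact: le_trans hA.
(* The hypothesis controls S^2 - 1 = (S - 1)(S + 1), and S + 1 >= 1. *)
have S1 : `|S - 1| <= C / r.
  have : `|S ^+ 2 - 1| <= C / r.
    have -> : S ^+ 2 - 1 = (sqnorm eps / s ^+ 2 - r ^+ 2) / r ^+ 2.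
      by rewrite /S -enorm_sqr; field; rewrite !gt_eqF.
    rewrite normrM [`|_^-1|]gtr0_norm ?invr_gt0 ?exprn_gt0//.
    rewrite ler_pdivrMr ?exprn_gt0// (le_trans hC)//.
    by rewrite expr2 mulrA divfK// gt_eqF.
  apply: le_trans; have -> : S ^+ 2 - 1 = (S - 1) * (S + 1) by ring.
  by rewrite normrM ler_peMr// ger0_norm; lra.
have C0 : 0 <= C / r by exact: le_trans S1.
have [Sl Su] : 1 / 2 <= S /\ S <= 2.
  by move: S1; rewrite ler_norml => /andP[]; rewrite /k in k2; split; lra.
pose x := sh / (enorm eps / r); pose q := x * S.
have epsr : enorm eps / r = S * s by rewrite /S divfK ?gt_eqF.
have shE : sh = q * s.
  rewrite /q -mulrA -epsr /x divfK// epsr gt_eqF// mulr_gt0//; lra.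
have q1 : `|q - 1| <= k.
  have -> : q - 1 = (x - 1) * S + (S - 1) by rewrite /q; ring.
  rewrite (le_trans (ler_normD _ _))// lerD// normrM (ger0_norm S0).
  by rewrite mulrC ler_pM.
have qh : 1 / 2 <= q.
  by move: q1; rewrite ler_norml => /andP[]; lra.
have q0 : 0 < q by lra.
have qV2 : q^-1 <= 2.
  by rewrite -[leRHS]invrK lef_pV2 ?posrE ?invr_gt0// -div1r.
split; first by rewrite shE mulf_neq0// gt_eqF.
have -> : sh^-1 *: (e1 + e2) - s^-1 *: e1 =
    (q^-1 - 1) *: (s^-1 *: e1) + q^-1 *: (s^-1 *: e2).
  rewrite shE invfM -scalerA !scalerDr scalerBl scale1r addrAC.
  by [].
rewrite (le_trans (ler_enormD _ _))// !enormZ (gtr0_norm (_ : 0 < q^-1)) ?invr_gt0//.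
rewrite [`|s^-1|]gtr0_norm ?invr_gt0// !(mulrC s^-1).
have e10 : 0 <= enorm e1 / s by rewrite divr_ge0 ?enorm_ge0// ltW.
have e20 : 0 <= enorm e2 / s by rewrite divr_ge0 ?enorm_ge0// ltW.
apply: lerD; last by rewrite ler_pM// invr_ge0 ltW.
apply: ler_pM => //.
have -> : q^-1 - 1 = (1 - q) * q^-1 by field; rewrite gt_eqF.
rewrite normrM distrC (gtr0_norm (_ : 0 < q^-1)) ?invr_gt0// mulrC.
by rewrite ler_pM ?invr_ge0 ?(ltW q0).
Qed.

(** * From approximation of norms to uniform distance of distribution functions *)

Section kolmogorov_distance.
Context {R : realType}.

Lemma fine_prob_dist d (T : measurableType d) (P : probability T R)
    (A B C : set T) : measurable A -> measurable B -> measurable C ->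
  A `<=` B `|` C -> B `<=` A `|` C ->
  `|fine (P A) - fine (P B)| <= fine (P C).
Proof.
move=> mA mB mC AB BA.
have le A' B' : measurable A' -> measurable B' -> A' `<=` B' `|` C ->
    fine (P A') <= fine (P B') + fine (P C).
  move=> mA' mB' h.
  rewrite -lee_fin EFinD !fineK ?fin_num_measure//.
  apply: le_trans (measureU2 _ mB' mC).
  by apply: le_measure; rewrite ?inE//; exact: measurableU.
have := le _ _ mA mB AB; have := le _ _ mB mA BA.
by rewrite ler_norml => h1 h2; apply/andP; split; lra.
Qed.

Lemma sup_dist_cvg0 (F H : nat -> R -> R) :
  (forall e, 0 < e -> \forall n \near \oo, forall t, `|F n t - H n t| <= e) ->
  sup_dist (F n) (H n) @[n --> \oo] --> (0 : R).
Proof.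
move=> FH; apply/cvgrPdist_le => e e0; near=> n.
have Fn : forall t, `|F n t - H n t| <= e by near: n; exact: FH.
have ne : range (fun t => `|F n t - H n t|) !=set0.
  by exists `|F n 0 - H n 0|; exists 0.
rewrite sub0r normrN ger0_norm.
  by rewrite /sup_dist; apply: ge_sup => // _ [t _ <-].
rewrite /sup_dist; apply: le_trans (normr_ge0 (F n 0 - H n 0)) _.
by apply: ub_le_sup; [exists e => _ [t _ <-]|exists 0].
Unshelve. all: by end_near. Qed.

(** [W] has exactly the chi law and [U] is close to it off [bad]. The events U^2 <= t and W^2 <= t
    can then differ only on [bad] or where [W] is near the square root of t, which is unlikely by
    anticoncentration. *)
Lemma chi2_cdf_cvg (d : nat -> measure_display)
    (T : forall n, measurableType (d n)) (P : forall n, probability (T n) R)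
    (k : nat -> nat) (U W : forall n, T n -> R)
    (bad : R -> forall n, set (T n)) (A : forall n, R -> set (T n)) :
  (forall n w, 0 <= U n w) -> (forall n w, 0 <= W n w) ->
  (forall n E, measurable E -> P n [set w | E (W n w ^+ 2)] =
     std_normal (k n) [set z | E (sqnorm z)]) ->
  (forall n, measurable_fun [set: T n] (W n)) ->
  (forall n w, k n = 0%N -> U n w = W n w) ->
  (forall h n, measurable (bad h n)) ->
  (forall h n w, ~ bad h n w -> `|U n w - W n w| <= h) ->
  (forall h n t w, ~ bad h n w -> A n t w <-> U n w ^+ 2 <= t) ->
  (forall h e, 0 < h -> 0 < e ->
     \forall n \near \oo, (P n (bad h n) <= e%:E)%E) ->
  (forall n t, measurable (A n t)) ->
  sup_dist (fun t => fine (P n (A n t))) (chi2_cdf (k n)) @[n --> \oo] --> (0 : R).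
Proof.
move=> U0 W0 law mW k0 mbad hbad badA Pbad mA.
apply: sup_dist_cvg0 => e e0.
have e20 : 0 < e / 2 by rewrite divr_gt0.
have [D D0 chiD] := chi_anticoncentration e20.
have D20 : 0 < D / 2 by rewrite divr_gt0.
near=> n => t.
have Pn : (P n (bad (D / 2)%R n) <= (e / 2)%:E)%E by near: n; exact: Pbad.
pose B := [set w | W n w ^+ 2 <= t].
have mB : measurable B.
  rewrite [B](_ : _ = (fun w => W n w ^+ 2) @^-1` `]-oo, t]); last first.
    by apply/seteqP; split => w; rewrite /= in_itv.
  rewrite -[X in measurable X]setTI; apply: measurable_funX => //.
have -> : chi2_cdf (k n) t = fine (P n B).
  have mt : measurable [set x : R | x <= t].
    have -> : [set x : R | x <= t] = `]-oo, t]%classic.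
      by apply/seteqP; split => w /=; rewrite in_itv.
    exact: measurable_itv.
  by rewrite /chi2_cdf -(law n _ mt).
pose S := if k n == 0%N then set0 else
  [set w | Num.sqrt t - D / 2 < W n w <= Num.sqrt t - D / 2 + D].
have mS : measurable S.
  rewrite /S; case: ifP => // _.
  rewrite [X in measurable X](_ : _ =
    W n @^-1` `]Num.sqrt t - D / 2, Num.sqrt t - D / 2 + D]); last first.
    by apply/seteqP; split => w; rewrite /= in_itv.
  by rewrite -[X in measurable X]setTI; apply: mW.
have PS : (P n S <= (e / 2)%:E)%E.
  rewrite /S; case: ifPn => [_|kn0]; first by rewrite measure0 lee_fin ltW.
  set x := Num.sqrt t - D / 2.
  pose E := [set q : R | x < Num.sqrt q <= x + D].
  have mE : measurable E.
    rewrite [E](_ : _ = Num.sqrt @^-1` `]x, x + D]); last first.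
      by apply/seteqP; split => w; rewrite /= in_itv.
    rewrite -[X in measurable X]setTI.
    by apply: (continuous_measurable_fun (@sqrt_continuous R)).
  rewrite [X in P n X](_ : _ = [set w | E (W n w ^+ 2)]); last first.
    by apply/seteqP; split => w; rewrite /E /= sqrtr_sqr ger0_norm.
  by rewrite law//; apply: chiD; rewrite lt0n.
have mC := measurableU _ _ (mbad (D / 2) n) mS.
have PC : fine (P n (bad (D / 2) n `|` S)) <= e.
  rewrite -lee_fin fineK ?fin_num_measure//.
  apply: (le_trans (measureU2 _ (mbad (D / 2) n) mS)).
  by rewrite [e]splitr EFinD leeD.
apply: le_trans PC; apply: fine_prob_dist => //.
- move=> w Aw; have [bw|nbw] := pselect (bad (D / 2) n w); first by right; left.
  have /badA : ~ bad (D / 2) n w by [].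
  move=> /(_ t) [/(_ Aw) Ut _].
  have := hbad _ _ _ nbw; rewrite ler_norml => /andP[UW1 UW2].
  have [Wt|tW] := leP (W n w ^+ 2) t; first by left.
  right; right; rewrite /S; case: eqP => [kn|_].
    by move: tW; rewrite -(k0 n w kn) ltNge Ut.
  (* A negative [t] makes both events empty, so square roots may be taken once the events differ. *)
  have t0 : 0 <= t by rewrite (le_trans _ Ut) ?sqr_ge0.
  have Us : U n w <= Num.sqrt t.
    by rewrite -[leLHS]ger0_norm// -sqrtr_sqr ler_wsqrtr.
  have Ws : Num.sqrt t < W n w.
    by rewrite -[ltRHS]ger0_norm// -sqrtr_sqr ltr_sqrt// (le_lt_trans t0).
  by rewrite /=; apply/andP; split; lra.
- move=> w Bw; have [bw|nbw] := pselect (bad (D / 2) n w); first by right; left.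
  have /badA : ~ bad (D / 2) n w by [].
  move=> /(_ t) [_ UA].
  have := hbad _ _ _ nbw; rewrite ler_norml => /andP[UW1 UW2].
  have [Ut|tU] := leP (U n w ^+ 2) t; first by left; exact: UA.
  right; right; rewrite /S; case: eqP => [kn|_].
    by move: tU; rewrite (k0 n w kn) ltNge Bw.
  have t0 : 0 <= t by rewrite (le_trans _ Bw) ?sqr_ge0.
  have Ws : W n w <= Num.sqrt t.
    by rewrite -[leLHS]ger0_norm// -sqrtr_sqr ler_wsqrtr.
  have Us : Num.sqrt t < U n w.
    by rewrite -[ltRHS]ger0_norm// -sqrtr_sqr ltr_sqrt// (le_lt_trans t0).
  by rewrite /=; apply/andP; split; lra.
Unshelve. all: by end_near. Qed.

End kolmogorov_distance.

(** * Measurability of vector-valued statistics *)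

Section measurable_matrix_functions.
Context {R : realType} d (T : measurableType d).

Lemma measurable_entry m n (f : T -> 'M[R]_(m, n)) i j :
  measurable_fun [set: T] f -> measurable_fun [set: T] (fun w => f w i j).
Proof. by move=> mf; exact: (measurableT_comp (measurable_coord i j) mf). Qed.

Lemma measurable_addmx m n (f g : T -> 'M[R]_(m, n)) :
  measurable_fun [set: T] f -> measurable_fun [set: T] g ->
  measurable_fun [set: T] (fun w => f w + g w).
Proof.
move=> mf mg; apply: measurable_fun_matrix => i j; under eq_fun do rewrite mxE.
by apply: measurable_funD; exact: measurable_entry.
Qed.

Lemma measurable_submx m n (f g : T -> 'M[R]_(m, n)) :
  measurable_fun [set: T] f -> measurable_fun [set: T] g ->
  measurable_fun [set: T] (fun w => f w - g w).
Proof.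
move=> mf mg; apply: measurable_fun_matrix => i j; under eq_fun do rewrite !mxE.
by apply: measurable_funB; exact: measurable_entry.
Qed.

Lemma measurable_scaler_mx m n (a : T -> R) (f : T -> 'M[R]_(m, n)) :
  measurable_fun [set: T] a -> measurable_fun [set: T] f ->
  measurable_fun [set: T] (fun w => a w *: f w).
Proof.
move=> ma mf; apply: measurable_fun_matrix => i j; under eq_fun do rewrite mxE.
by apply: measurable_funM => //; exact: measurable_entry.
Qed.

Lemma measurable_mulmx_l m n p (A : 'M[R]_(m, n)) (f : T -> 'M[R]_(n, p)) :
  measurable_fun [set: T] f -> measurable_fun [set: T] (fun w => A *m f w).
Proof. by move=> mf; exact: (measurableT_comp (measurable_mulmx A) mf). Qed.

Lemma measurable_subv p (A : {set 'I_p}) (f : T -> 'cV[R]_p) :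
  measurable_fun [set: T] f -> measurable_fun [set: T] (fun w => subv A (f w)).
Proof.
move=> mf; apply: measurable_fun_matrix => i j; under eq_fun do rewrite mxE.
exact: measurable_entry.
Qed.

Lemma measurable_enorm_comp n (f : T -> 'cV[R]_n) :
  measurable_fun [set: T] f -> measurable_fun [set: T] (fun w => enorm (f w)).
Proof. by move=> mf; exact: (measurableT_comp (@measurable_enorm R n) mf). Qed.

Lemma measurable_set_le (f g : T -> R) : measurable_fun [set: T] f ->
  measurable_fun [set: T] g -> measurable [set w | f w <= g w].
Proof.
move=> mf mg.
have mfg : measurable_fun [set: T] (fun w => f w - g w) by exact: measurable_funB.
rewrite [X in measurable X](_ : _ = (fun w => f w - g w) @^-1` `]-oo, 0]).
  by rewrite -[X in measurable X]setTI; apply: mfg.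
by apply/seteqP; split => w; rewrite /= in_itv/= subr_le0.
Qed.

Lemma measurable_set_lt (f g : T -> R) : measurable_fun [set: T] f ->
  measurable_fun [set: T] g -> measurable [set w | f w < g w].
Proof.
move=> mf mg; rewrite [X in measurable X](_ : _ = ~` [set w | g w <= f w]).
  exact: measurableC (measurable_set_le mg mf).
by apply/seteqP; split => w /=; rewrite ltNge => /negP.
Qed.

(** Inversion is continuous off 0, and the point 0 is treated as a separate measurable piece. *)
Lemma measurable_inv_comp (f : T -> R) : measurable_fun [set: T] f ->
  measurable_fun [set: T] (fun w => (f w)^-1).
Proof.
move=> mf; suff mV : measurable_fun [set: R] (@GRing.inv R).
  exact: (measurableT_comp mV mf).
rewrite -(setvU [set 0]); apply/measurable_funU => //.
  by apply: measurableC; exact: measurable_set1.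
split; last exact: measurable_fun_set1.
apply: open_continuous_measurable_fun.
  exact/closed_openC/accessible_closed_set1/hausdorff_accessible/Rhausdorff.
by move=> x; rewrite inE/= => /eqP; exact: inv_continuous.
Qed.

End measurable_matrix_functions.

(** * Linear images of Gaussian vectors *)

Section gaussian_linear.
Context {R : realType} d (T : measurableType d) (P : probability T R).
Context {m n : nat}.

(** Named so that it can carry the random-variable structure; it will provide the Gaussian part of
    the studentised error. *)
Definition linear_RV (L : 'M[R]_(m, n)) (V : {RV P >-> 'cV[R]_n}) :
  T -> 'cV[R]_m := fun w => L *m V w.

Lemma measurable_linear_RV L V : measurable_fun [set: T] (linear_RV L V).
Proof. by apply: measurable_mulmx_l; exact: measurable_funPT. Qed.

HB.instance Definition _ L V := @isMeasurableFun.Build _ _ _ _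
  (linear_RV L V) (measurable_linear_RV L V).

Lemma is_gaussian_linear L (V : {RV P >-> 'cV[R]_n}) S :
  is_gaussian V S -> is_gaussian (linear_RV L V : {RV P >-> 'cV[R]_m}) (L *m S *m L^T).
Proof.
move=> [l [A [AA VA]]]; exists l, (L *m A); split.
  by rewrite trmx_mul mulmxA -(mulmxA L) AA.
move=> B mB; pose B' := [set v : 'cV[R]_n | B (L *m v)].
have mB' : measurable B'.
  by have := measurable_mulmx L measurableT mB; rewrite setTI.
transitivity (distribution P V B'); first by [].
rewrite VA//; congr (std_normal l _).
by apply/seteqP; split => z; rewrite /B' /= mulmxA.
Qed.

End gaussian_linear.

(* The n-th model has sample size n.+1. *)
Theorem theorem2 (R : realType)
  (d : nat -> measure_display) (T : forall n, measurableType (d n))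
  (P : forall n, probability (T n) R)
  (p M : nat -> nat) (g s : nat -> nat)
  (X : forall n, 'M[R]_(n.+1, p n))
  (Gr : forall n, 'I_(M n) -> {set 'I_(p n)})
  (G : forall n, {set 'I_(p n)})
  (beta : forall n, 'cV[R]_(p n)) (sigma : nat -> R)
  (eps : forall n, {RV (P n) >-> 'cV[R]_n.+1})
  (omega' : forall n, 'I_(M n) -> R)
  (PG : forall n, 'M[R]_n.+1)
  (hbeta : forall n, {mfun 'cV[R]_n.+1 >-> 'cV[R]_(p n)})
  (hsigma : forall n, {mfun 'cV[R]_n.+1 >-> R}) :
  let y n w := X n *m beta n + eps n w in
  let Q n := orthproj (subm (G n) (X n)) in
  let binit n w := hbeta n (y n w) in
  let shat n w := hsigma n (y n w) in
  let sigma_star n w := enorm (y n w - X n *m beta n) / Num.sqrt n.+1%:R in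
  let size_n n := (s n)%:R + (g n)%:R * ln (M n)%:R : R in
  let bG n w := debiased (X n) (G n) (PG n) (binit n w) (y n w) in
  let muhat n w := subm (G n) (X n) *m bG n w in
  let mustar n := subm (G n) (X n) *m subv (G n) (beta n) in
  let err_b n w := PG n *m subm (G n) (X n) *m (bG n w - subv (G n) (beta n)) in
  let err_mu n w := PG n *m Q n *m (muhat n w - mustar n) in
  let TG n w := test_stat (X n) (Gr n) (G n) (PG n) (binit n w) (shat n w) (y n w) in
  (forall n, 0 < sigma n) ->
  (forall n, group_partition (Gr n)) ->
  (forall n, (0 < #|G n|)%N) ->
  (forall n (k : 'I_(M n)), ~~ (Gr n k \subset G n) -> 0 <= omega' n k) ->
  (forall n, PG n = PG n *m PG n /\ PG n = (PG n)^T) ->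
  (forall n (k : 'I_(M n)), ~~ (Gr n k \subset G n) ->
    spectral_norm (PG n *m orthproj (subm (Gr n k :\: G n) (X n))) <= omega' n k) ->
  (forall n, spectral_norm (PG n *m (1%:M - Q n)) < 1) ->
  (forall n, strongly_group_sparse (Gr n) (g n) (s n) (beta n)) ->
  bigO_p P
    (fun n w => `|shat n w / sigma_star n w - 1| +
       (Num.sqrt n.+1%:R)^-1 *
         group_error (X n) (Gr n) (binit n w) (beta n) (sigma n))
    (fun n => size_n n / n.+1%:R) ->
  (forall n, is_gaussian (eps n) ((sigma n ^+ 2)%:M)) ->
  (forall n, \rank (subm (G n) (X n)) = #|G n|) ->
  (#|G n|%:R / n.+1%:R : R) @[n --> \oo] --> (0 : R) ->
  (\forall n \near \oo, (max_ratio (X n) (Gr n) (G n) (@omega' n) < +oo)%E) ->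
  ((size_n n / Num.sqrt n.+1%:R)%:E *
     ((Num.sqrt #|G n|%:R / Num.sqrt n.+1%:R)%:E +
        max_ratio (X n) (Gr n) (G n) (@omega' n)))%E @[n --> \oo] --> 0%E ->
  [/\ sup_dist
        (fun t => fine (P n [set w | enorm (err_b n w) ^+ 2 <= shat n w ^+ 2 * t]))
        (chi2_cdf (\rank (PG n))) @[n --> \oo] --> (0 : R),
      sup_dist
        (fun t => fine (P n [set w | enorm (err_mu n w) ^+ 2 <= shat n w ^+ 2 * t]))
        (chi2_cdf (\rank (PG n))) @[n --> \oo] --> (0 : R),
      (forall n, mustar n = 0) ->
        sup_dist (fun t => fine (P n [set w | TG n w ^+ 2 <= t]))
          (chi2_cdf (\rank (PG n))) @[n --> \oo] --> (0 : R) &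
      (forall n w, (shat n w)^-1 *: err_mu n w = (shat n w)^-1 *: err_b n w) /\
      gaussian_plus_littleo_p P
        (fun n w => (shat n w)^-1 *: err_mu n w) PG].
Proof.
move=> y Q binit shat sigma_star size_n bG muhat mustar err_b err_mu TG.
move=> sigma0 partG G0 omega0 PPs PQ PQ1 sparse bigO gauss rankX G_n mroo sz.
have PP n : PG n *m PG n = PG n by rewrite -(PPs n).1.
have PT n : (PG n)^T = PG n by rewrite -(PPs n).2.
have meps n : measurable_fun [set: T n] (eps n) by exact: measurable_funPT.
have my n : measurable_fun [set: T n] (y n).
  by apply: measurable_addmx => //; exact: measurable_cst.
have mb n : measurable_fun [set: T n] (binit n).
  exact: (measurableT_comp (measurable_funPT (hbeta n)) (my n)).
have ms n : measurable_fun [set: T n] (shat n).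
  exact: (measurableT_comp (measurable_funPT (hsigma n)) (my n)).
pose e1 n w := PG n *m eps n w.
pose e2 n w := PG n *m bias (X n) (@Gr n) (G n) (beta n) (binit n w).
have err_bE n w : err_b n w = e1 n w + e2 n w.
  by rewrite /err_b /bG /y (debiased_errorE _ _ _ (partG n))// mulmxDr.
have err_muE n w : err_mu n w = err_b n w.
  exact: prediction_errorE.
have merr n : measurable_fun [set: T n] (err_b n).
  apply: measurable_mulmx_l; apply: measurable_submx; last exact: measurable_cst.
  apply: measurable_addmx; first exact: measurable_subv.
  apply: measurable_mulmx_l; apply: measurable_submx => //.
  exact: measurable_mulmx_l.
have me1 n : measurable_fun [set: T n] (e1 n) by exact: measurable_mulmx_l.
pose U n w := enorm ((shat n w)^-1 *: err_b n w).
pose W n w := enorm (e1 n w) / sigma n.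
pose rv n w := (shat n w)^-1 *: err_b n w - (sigma n)^-1 *: e1 n w.
have mrv n : measurable_fun [set: T n] (rv n).
  apply: measurable_submx.
    by apply: measurable_scaler_mx => //; exact: measurable_inv_comp.
  by apply: measurable_scaler_mx => //; exact: measurable_cst.
(* Where [shat] vanishes, [U] takes a default value and the comparison with [shat ^+ 2 * t] no
   longer amounts to a bound on [U], so these points count as bad. *)
pose bad h n := [set w | shat n w = 0] `|` [set w | h < enorm (rv n w)].
have mbad h n : measurable (bad h n).
  apply: measurableU; last first.
    by apply: measurable_set_lt; [exact: measurable_cst|exact: measurable_enorm_comp].
  by have := ms n measurableT _ (measurable_set1 0); rewrite setTI.
have WE n w : W n w = enorm ((sigma n)^-1 *: e1 n w).
  by rewrite enormZ gtr0_norm ?invr_gt0// mulrC.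
have law n E : measurable E -> P n [set w | E (W n w ^+ 2)] =
     std_normal (\rank (PG n)) [set z | E (sqnorm z)].
  move=> mE; rewrite -(gaussian_sqnorm_law (sigma0 n) (gauss n) (PT n) (PP n) mE).
  congr (P n _); apply/seteqP; split => w /=;
  by rewrite /W exprMn enorm_sqr exprVn.
have Pbad h e : 0 < h -> 0 < e ->
    \forall n \near \oo, (P n (bad h n) <= e%:E)%E.
  move=> h0 e0; have e30 : 0 < e / 3 by rewrite divr_gt0.
  have [C0 HC] := bigO _ e30.
  have [C1 C10 conc] := chi_square_concentration e30.
  have [C2 C20 tail] := chi_square_tail e30.
  (* The constant behind a bounded-in-probability statement may be negative. *)
  pose C := Num.max C0 0; have C0C : C0 <= C by rewrite le_max lexx.
  have Cge0 : 0 <= C by rewrite le_max lexx orbT.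
  (* When the hypotheses are within [del / 2] of their limits, [K * (del / 2)] bounds the scale
     error times |G|^(1/2), and [L * del] the whole error. [del] makes the former at most 1/2 and
     the latter at most [h]. *)
  pose K := 2 * C + C1; pose L := 2 * K * Num.sqrt C2 + 2 * C.
  have K0 : 0 <= K by rewrite /K; lra.
  have L0 : 0 <= L by rewrite addr_ge0 ?mulr_ge0 ?sqrtr_ge0.
  pose del := Num.min (1 / (2 * (K + 1))) (h / (L + 1)).
  have del0 : 0 < del by rewrite lt_min !divr_gt0//; lra.
  have del2 : del / 2 <= del by rewrite ler_pdivrMr// ler_peMr ?ler1n// ltW.
  have Kdel : K * del <= 1 / 2.
    have : del <= 1 / (2 * (K + 1)) by rewrite ge_min lexx.
    by rewrite ler_pdivlMr; lra.
  have Ldel : L * del <= h.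
    have : del <= h / (L + 1) by rewrite ge_min lexx orbT.
    by rewrite ler_pdivlMr; lra.
  have d20 : 0 < del / 2 by rewrite divr_gt0.
  have /fine_cvgP[_ sz_fine] := sz.
  (* Squared because the ratio |G| / n enters through its square root. *)
  have d22 : 0 < (del / 2) ^+ 2 by rewrite exprn_gt0.
  have /cvgrPdist_le/(_ _ d22) Gnear := G_n.
  have /cvgrPdist_le/(_ _ d20) sznear := sz_fine.
  near=> n.
  have Gn : `|0 - #|G n|%:R / n.+1%:R| <= (del / 2) ^+ 2.
    by near: n; exact: Gnear.
  have szn : `|0 - fine ((size_n n / Num.sqrt n.+1%:R)%:E *
      ((Num.sqrt #|G n|%:R / Num.sqrt n.+1%:R)%:E +
        max_ratio (X n) (Gr n) (G n) (@omega' n)))%E| <= del / 2.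
    by near: n; exact: sznear.
  have P1 : (P n [set w | (C0 * (size_n n / n.+1%:R) <
      `| `|shat n w / sigma_star n w - 1| + (Num.sqrt n.+1%:R)^-1 *
      group_error (X n) (Gr n) (binit n w) (beta n) (sigma n)|)%R] <= (e / 3)%:E)%E.
    by near: n.
  have n64 : (64 <= n.+1)%N by near: n; exists 64%N => // n /= /leqW.
  have mrf : (max_ratio (X n) (Gr n) (G n) (@omega' n) < +oo)%E by near: n.
  set mr := fine (max_ratio (X n) (Gr n) (G n) (@omega' n)).
  have mr0 : (0 <= max_ratio (X n) (Gr n) (G n) (@omega' n))%E.
    by apply: max_ratio_ge0; [exact: partG|exact: omega0|].
  have mrE : max_ratio (X n) (Gr n) (G n) (@omega' n) = mr%:E.
    by rewrite fineK// ge0_fin_numE.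
  have {}mr0 : 0 <= mr by rewrite fine_ge0.
  set N : R := n.+1%:R; set r := Num.sqrt N; set gs : R := Num.sqrt #|G n|%:R.
  have r0 : 0 < r by rewrite sqrtr_gt0 ltr0n.
  have rN : r ^+ 2 = N by rewrite sqr_sqrtr.
  have gs1 : 1 <= gs by rewrite -sqrtr1 ler_wsqrtr// ler1n.
  have sz0 : 0 <= size_n n.
    rewrite addr_ge0// mulr_ge0//; case: (M n) => [|m]; first by rewrite ln0.
    by rewrite ln_ge0// ler1n.
  have u2 : gs / r <= del / 2.
    move: Gn; rewrite sub0r normrN ger0_norm ?divr_ge0// => GN.
    have u0 : 0 <= gs / r by exact: divr_ge0 (sqrtr_ge0 _) (ltW r0).
    have -> : gs / r = Num.sqrt (#|G n|%:R / N) by rewrite sqrtrM ?sqrtrV.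
    by rewrite -[leRHS]gtr0_norm// -sqrtr_sqr ler_wsqrtr.
  have v2 : size_n n / r * (gs / r + mr) <= del / 2.
    move: szn; rewrite -/N -/r -/gs.
    by rewrite mrE -EFinD -EFinM sub0r normrN; apply: le_trans; exact: ler_norm.
  pose a := size_n n / N; have a0 : 0 <= a by rewrite divr_ge0.
  have aE : a * r = size_n n / r by rewrite /a -rN; field; rewrite gt_eqF.
  have agE : a * gs = size_n n / r * (gs / r) by rewrite /a -rN; field; rewrite gt_eqF.
  have szr0 : 0 <= size_n n / r by rewrite divr_ge0// ltW.
  have ag : a * gs <= del / 2.
    by rewrite agE (le_trans _ v2)// ler_wpM2l// lerDl.
  have am : mr * (a * r) <= del / 2.
    by rewrite aE mulrC (le_trans _ v2)// ler_wpM2l// lerDr divr_ge0 ?sqrtr_ge0// ltW.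
  have kg : (2 * (C * a) + C1 / r) * gs <= K * (del / 2).
    have -> : (2 * (C * a) + C1 / r) * gs = 2 * C * (a * gs) + C1 * (gs / r) by ring.
    rewrite /K [leRHS]mulrDl; apply: lerD.
      by apply: ler_wpM2l => //; rewrite mulr_ge0.
    exact: ler_wpM2l (ltW C10) _ _ u2.
  have k0 : 0 <= 2 * (C * a) + C1 / r.
    apply: addr_ge0; last exact: divr_ge0 (ltW C10) (ltW r0).
    by apply: mulr_ge0 => //; exact: mulr_ge0.
  (* Only the product with [gs] is controlled by the hypotheses; [gs >= 1], as [G] is nonempty,
     gives the scale error alone. *)
  have k2 : 2 * (C * a) + C1 / r <= 1 / 2.
    apply: (@le_trans _ _ ((2 * (C * a) + C1 / r) * gs)); first by rewrite ler_peMr.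
    by rewrite (le_trans kg)// (le_trans _ Kdel)// ler_wpM2l.
  (* Three exceptional events of probability at most [e / 3]: the initial estimators miss their
     rate, |eps|^2 deviates from its mean, or |P_G eps|^2 is large against the rank of P_G. Off them
     the error bound is deterministic. *)
  pose B1 := [set w | (C0 * a < `| `|shat n w / sigma_star n w - 1| + r^-1 *
    group_error (X n) (Gr n) (binit n w) (beta n) (sigma n)|)%R].
  pose B2 := [set w | C1 * r < `|sqnorm (eps n w) / sigma n ^+ 2 - N|].
  pose B3 := [set w | C2 * (\rank (PG n))%:R < W n w ^+ 2].
  have mB1 : measurable B1.
    apply: measurable_set_lt; first exact: measurable_cst.
    apply: (measurableT_comp (@normr_measurable R setT)).
    apply: measurable_funD.
      apply: (measurableT_comp (@normr_measurable R setT)).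
      apply: measurable_funB => //; apply: measurable_funM => //.
      apply: measurable_inv_comp; apply: measurable_funM => //.
      by apply: measurable_enorm_comp; exact: measurable_submx.
    apply: measurable_funM => //; apply: measurable_sum => k.
    apply: measurable_funM => //; apply: measurable_enorm_comp.
    apply: measurable_submx; apply: measurable_mulmx_l => //.
    exact: measurable_subv.
  have mB2 : measurable B2.
    apply: measurable_set_lt; first exact: measurable_cst.
    apply: (measurableT_comp (@normr_measurable R setT)).
    apply: measurable_funB => //; apply: measurable_funM => //.
    exact: (measurableT_comp (@measurable_sqnorm R n.+1) (meps n)).
  have mB3 : measurable B3.
    apply: measurable_set_lt; first exact: measurable_cst.
    by apply: measurable_funX; apply: measurable_funM => //; exact: measurable_enorm_comp.
  have P2 : (P n B2 <= (e / 3)%:E)%E.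
    pose E := [set q : R | C1 * r < `|q - N|].
    have mE : measurable E.
      apply: measurable_set_lt; first exact: measurable_cst.
      apply: (measurableT_comp (@normr_measurable R setT)).
      exact: measurable_funB.
    have := gaussian_sqnorm_law (sigma0 n) (gauss n) (trmx1 _ _) (mul1mx _) mE.
    rewrite mxrank1 /E => PE.
    rewrite (le_trans _ (conc n.+1 n64))// -PE.
    rewrite le_eqVlt; apply/orP; left; apply/eqP; congr (P n _).
    by apply/seteqP; split => w; rewrite /B2 /= mul1mx.
  have P3 : (P n B3 <= (e / 3)%:E)%E.
    pose E := [set q : R | C2 * (\rank (PG n))%:R < q].
    have mE : measurable E.
      rewrite [E](_ : _ = `]C2 * (\rank (PG n))%:R, +oo[%classic)//.
      by apply/seteqP; split => w; rewrite /= in_itv/= andbT.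
    by have := law n E mE; rewrite /E /= => ->; exact: tail.
  apply: (@le_trans _ _ (P n (B1 `|` (B2 `|` B3)))); last first.
    apply: (le_trans (measureU2 _ mB1 (measurableU _ _ mB2 mB3))).
    have -> : e = e / 3 + (e / 3 + e / 3) by field.
    rewrite EFinD leeD// EFinD (le_trans (measureU2 _ mB2 mB3))// leeD//.
  apply: le_measure; rewrite ?inE//; first by do 2 apply: measurableU => //.
  move=> w bw; apply: contrapT => nB.
  have nB1 : ~ B1 w by move=> ?; apply: nB; left.
  have nB2 : ~ B2 w by move=> ?; apply: nB; right; left.
  have nB3 : ~ B3 w by move=> ?; apply: nB; right; right.
  set ge := group_error (X n) (Gr n) (binit n w) (beta n) (sigma n).
  have ge0 : 0 <= ge.
    apply: sumr_ge0 => k _; rewrite !mulr_ge0 ?enorm_ge0 ?invr_ge0 ?(ltW (sigma0 n))//.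
    by rewrite addr_ge0 ?sqrtr_ge0.
  have rge0 : 0 <= r^-1 * ge by rewrite mulr_ge0// invr_ge0 ltW.
  have Z : `|shat n w / sigma_star n w - 1| + r^-1 * ge <= C * a.
    apply: (@le_trans _ _ (C0 * a)); last by rewrite ler_wpM2r.
    by rewrite leNgt; apply/negP => Zlt; apply: nB1; rewrite /B1 /= ger0_norm ?addr_ge0.
  have hA : `|shat n w / (enorm (eps n w) / r) - 1| <= C * a.
    apply: le_trans Z; rewrite /sigma_star /y addrAC subrr add0r -/r.
    by rewrite lerDl.
  have gea : ge <= C * a * r.
    rewrite mulrC -ler_pdivrMl//; apply: le_trans Z; by rewrite lerDr.
  have hC : `|sqnorm (eps n w) / sigma n ^+ 2 - r ^+ 2| <= C1 * r.
    by rewrite leNgt rN; apply/negP.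
  have rkG : (\rank (PG n))%:R <= #|G n|%:R :> R.
    by rewrite ler_nat; exact: rank_proj_le (PP n) (PT n) (PQ1 n).
  have hw : enorm (e1 n w) / sigma n <= Num.sqrt C2 * gs.
    rewrite -[leLHS]ger0_norm ?divr_ge0 ?enorm_ge0 ?(ltW (sigma0 n))//.
    rewrite -sqrtr_sqr -sqrtrM ?(ltW C20)//; apply: ler_wsqrtr.
    apply: (@le_trans _ _ (C2 * (\rank (PG n))%:R)); last by rewrite ler_pM2l.
    by rewrite leNgt; apply/negP.
  have hm : enorm (e2 n w) / sigma n <= mr * (C * a * r).
    rewrite ler_pdivrMr//.
    apply: (le_trans (bias_bound _ _ (partG n) (sigma0 n) (omega0 n) (PQ n) _ mrf)) => //.
    by rewrite mulrC ler_wpM2r ?(ltW (sigma0 n))// ler_wpM2l.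
  have [s0 hrv] := studentized_error_bound (sigma0 n) r0 hA hC k2 hw hm.
  case: bw => [/= s00|]; first by rewrite s00 eqxx in s0.
  rewrite /= /rv err_bE ltNge => /negP; apply; apply: (le_trans hrv).
  apply: le_trans Ldel.
  have -> : 2 * (2 * (C * a) + C1 / r) * (Num.sqrt C2 * gs) + 2 * (mr * (C * a * r)) =
    2 * Num.sqrt C2 * ((2 * (C * a) + C1 / r) * gs) + 2 * C * (mr * (a * r)) by ring.
  have -> : L * del = 2 * Num.sqrt C2 * (K * del) + 2 * C * del by rewrite /L; ring.
  apply: lerD; apply: ler_wpM2l; rewrite ?mulr_ge0 ?sqrtr_ge0//.
    exact: le_trans kg (ler_wpM2l K0 del2).
  exact: le_trans am del2.
have cdf A : (forall n t, measurable (A n t)) ->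
    (forall h n t w, ~ bad h n w -> A n t w <-> U n w ^+ 2 <= t) ->
    sup_dist (fun t => fine (P n (A n t))) (chi2_cdf (\rank (PG n)))
      @[n --> \oo] --> (0 : R).
  move=> mA badA; apply: (@chi2_cdf_cvg R d T P _ U W bad) => //.
  - by move=> n w; exact: enorm_ge0.
  - by move=> n w; rewrite divr_ge0 ?enorm_ge0// ltW.
  - move=> n; apply: measurable_funM => //; exact: measurable_enorm_comp.
  - move=> n w /eqP; rewrite mxrank_eq0 => /eqP PG0.
    by rewrite /U /W err_bE /e1 /e2 PG0 !mul0mx addr0 scaler0 enorm0 mul0r.
  - move=> h n w nb; have rh : enorm (rv n w) <= h.
      by rewrite leNgt; apply/negP => rh; apply: nb; right.
    apply: le_trans rh; rewrite WE /U /rv; set u := _ *: _; set v := _ *: e1 _ _.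
    rewrite ler_norml; apply/andP; split.
      have := ler_enormD (v - u) u; rewrite subrK -[v - u]opprB enormN; lra.
    have := ler_enormD (u - v) v; rewrite subrK; lra.
have Usqr n w : U n w ^+ 2 = (shat n w ^+ 2)^-1 * enorm (err_b n w) ^+ 2.
  by rewrite !enorm_sqr sqnormZ exprVn.
have nbad h n t w : ~ bad h n w ->
    enorm (err_b n w) ^+ 2 <= shat n w ^+ 2 * t <-> U n w ^+ 2 <= t.
  move=> nb; have s2 : 0 < shat n w ^+ 2.
    by rewrite exprn_even_gt0//=; apply/eqP => s0; apply: nb; left.
  by rewrite Usqr ler_pdivrMl.
split.
- apply: (cdf (fun n t => [set w | enorm (err_b n w) ^+ 2 <= shat n w ^+ 2 * t])).
    move=> n t; apply: measurable_set_le.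
      by apply: measurable_funX; exact: measurable_enorm_comp.
    by apply: measurable_funM => //; exact: measurable_funX.
  by move=> h n t w nb; exact: nbad nb.
- apply: (cdf (fun n t => [set w | enorm (err_mu n w) ^+ 2 <= shat n w ^+ 2 * t])).
    move=> n t; under eq_fun do rewrite err_muE; apply: measurable_set_le.
      by apply: measurable_funX; exact: measurable_enorm_comp.
    by apply: measurable_funM => //; exact: measurable_funX.
  by move=> h n t w nb; rewrite /= err_muE; exact: nbad nb.
- move=> mu0.
  have TGE n w : TG n w ^+ 2 = U n w ^+ 2.
    rewrite /TG /y (test_statE _ _ _ (partG n) _ (mu0 n)) Usqr exprMn exprVn.
    by rewrite err_bE mulmxDr.
  apply: (cdf (fun n t => [set w | TG n w ^+ 2 <= t])).
    move=> n t; under eq_fun do rewrite TGE; apply: measurable_set_le.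
      apply: measurable_funX; apply: measurable_enorm_comp.
      by apply: measurable_scaler_mx => //; exact: measurable_inv_comp.
    exact: measurable_cst.
  by move=> h n t w _; rewrite /= TGE.
split; first by move=> n w; rewrite err_muE.
(* The Gaussian part is P_G eps / sigma, with covariance P_G P_G^T = P_G; the remainder is small
   because {|rv| > h} lies in [bad h]. *)
exists (fun n => linear_RV ((sigma n)^-1 *: PG n) (eps n)), rv; split.
- move=> n; have := is_gaussian_linear ((sigma n)^-1 *: PG n) (gauss n).
  rewrite [X in is_gaussian _ X -> _](_ : _ = PG n)//.
  have -> : ((sigma n)^-1 *: PG n)^T = (sigma n)^-1 *: PG n by rewrite linearZ/= PT.
  rewrite mul_mx_scalar -!scalemxAl -!scalemxAr !scalerA PP.
  by rewrite -[RHS]scale1r; congr (_ *: _); field; rewrite gt_eqF.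
- move=> n w; rewrite err_muE /rv /= /linear_RV -scalemxAl addrC subrK//.
- move=> h h0.
  rewrite (_ : (fun n => _) = (fun n => P n [set w | h < enorm (rv n w)])); last first.
    apply/funext => n; congr (P n _).
    by apply/seteqP; split => w /=; rewrite ger0_norm ?enorm_ge0.
  apply/fine_cvgP; split.
    apply: nearW => n; apply: fin_num_measure; apply: measurable_set_lt.
      exact: measurable_cst.
    exact: measurable_enorm_comp.
  apply/cvgrPdist_le => e e0; near=> n.
  rewrite sub0r normrN ger0_norm ?fine_ge0// -lee_fin fineK; last first.
    apply: fin_num_measure; apply: measurable_set_lt; first exact: measurable_cst.
    exact: measurable_enorm_comp.
  apply: (@le_trans _ _ (P n (bad h n))); last by near: n; exact: Pbad.
  apply: le_measure; rewrite ?inE//; last by move=> w hw; right.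
  apply: measurable_set_lt; first exact: measurable_cst.
  exact: measurable_enorm_comp.
Unshelve. all: by end_near. Qed.
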